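(* Let $G$ and $G'$ be finitely generated groups and let $f\colon \mathcal{C}(G) \to \mathcal{C}(G')$ be a quasi-isometry. Let $H$ be a subgroup of $G$ such that $\tilde{e}(G,H) \geq 3$ and, for any infinite index subgroup $K$ of $H$, $\tilde{e}(G,K)=1$. Suppose that sufficiently large uniform neighborhoods of $f(H)$ in $\mathcal{C}(G')$ satisfy the noncrossing condition, and let $H'$ be a subgroup of $G'$ such that $d_{Haus}(H',f(H))<\infty$. Let $f'$ be a quasi-inverse to $f$, and suppose there is some $R_0 >0$ such that, for all $R> R_0$, both $$\{ gN_R(f'(c'H'))\}_{g \in G,\ c' \in Comm_{G'}(H')}$$ and $$\{ g' N_R(f(cH))\}_{g' \in G',\ c \in Comm_G(H)}$$ satisfy the noncrossing condition. Then $$d_{Haus}(Comm_{G'}(H'), f(Comm_G(H)))<\infty.$$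
   Context: Every finitely generated group $G$ comes with a fixed finite generating set. $\mathcal{C}(G)$ is its Cayley graph: vertex set $G$, with $g,g'$ joined by an edge iff $g'=gs$ where $s$ or $s^{-1}$ is a generator; edges have length one. $G$ acts on $\mathcal{C}(G)$ by isometries on the left. Subgroups and cosets are regarded as sets of vertices. $d_{Haus}$ is Hausdorff distance. A quasi-inverse to a quasi-isometry $f\colon X\to Y$ is a quasi-isometry $f'\colon Y\to X$ such that $f'f$ and $ff'$ are at finite sup-distance from the identities. In a metric space $X$, $N_r(Y)=\{x: d(x,Y)\le r\}$; a uniform neighborhood of $Y$ is a set $N_r(Y)$, $r\ge0$. A component of $X-Z$ is shallow if it is contained in some uniform neighborhood of $Z$, and deep otherwise. A collection $\mathcal{Y}$ of subsets of $X$ satisfies the noncrossing condition if there is $k>0$ such that for every two distinct members $Y_1\ne Y_2$ of $\mathcal{Y}$, $Y_1$ is contained in the $k$-neighborhood of some deep component of $X-Y_2$. If $G$ acts on $X$, a subset $Y\subseteq X$ satisfies the noncrossing condition if the collection $\{gY\}_{g\in G}$ does. ''Sufficiently large uniform neighborhoods of $f(H)$ satisfy the noncrossing condition'' means that there is some $R_1\geq 0$ such that $N_R(f(H))$ satisfies it for all $R\ge R_1$. For a subgroup $H$ of $G$, $Comm_G(H)=\{g\in G: H \text{ and } g^{-1}Hg \text{ are commensurable}\}$, where two subgroups are commensurable if their intersection has finite index in each. Number of coends: a subset of $G$ is $H$-finite if it is contained in finitely many cosets $Hg$. Let $\mathcal{P}(G)$ be the power set of $G$ and $\mathcal{F}_H(G)$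 the set of $H$-finite subsets; under symmetric difference $\mathcal{P}(G)/\mathcal{F}_H(G)$ is an $\mathbb{F}_2$-vector space on which $G$ acts on the right, and $\tilde e(G,H)=\dim_{\mathbb{F}_2}(\mathcal{P}(G)/\mathcal{F}_H(G))^G$ (the dimension of the fixed subspace). *)

(* Defs.v *)
From HB Require Import structures.
From mathcomp Require Import all_boot all_order all_algebra.
From mathcomp Require Import generic_quotient ring_quotient.
From mathcomp Require Import all_classical all_reals all_analysis.
From mathcomp Require Import lra.

Set Implicit Arguments.
Unset Strict Implicit.
Unset Printing Implicit Defensive.

Import Order.TTheory GRing.Theory Num.Theory.

Local Open Scope classical_set_scope.
Local Open Scope ring_scope.

Section Groups.
Variable G : groupType.
Implicit Types H K : set G.

Definition subgroup H :=
  [/\ H 1%g, forall x y, H x -> H y -> H (x * y)%g & forall x, H x -> H (x^-1)%g].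

Definition lcoset (g : G) H : set G := [set (g * h)%g | h in H].

Definition rcoset H (g : G) : set G := [set (h * g)%g | h in H].

Definition finite_index K H := finite_set [set lcoset h K | h in H].

Definition commensurable H K :=
  finite_index (H `&` K) H /\ finite_index (H `&` K) K.

(* [(h ^ g)%g] is [g^-1 * h * g]. *)
Definition Comm H : set G := [set g | commensurable H [set (h ^ g)%g | h in H]].

End Groups.

(* Finite or infinite dimension of a subspace [W]: the supremum of the sizes of
   the linearly independent families in [W]; all infinite dimensions are [+oo]. *)
Section Dimension.
Variables (R : realType) (F : fieldType) (V : lmodType F).

Definition lin_indep n (v : 'I_n -> V) :=
  forall c : 'I_n -> F, \sum_i c i *: v i = 0 -> forall i, c i = 0.

Definition subspace_dim (W : set V) : \bar R :=
  ereal_sup [set (n%:R)%:E | n in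
    [set n : nat | exists2 v : 'I_n -> V, (forall i, W (v i)) & lin_indep v]].

End Dimension.

(* An alias of [set G], so that addition as symmetric difference is not declared
   on all sets. *)
Definition pset (G : Type) : Type := set G.

HB.instance Definition _ (G : Type) := Choice.copy (pset G) (set G).
HB.instance Definition _ (G : Type) :=
  GRing.isZmodule.Build (pset G)
    (@setYA G) (@setYC G) (@set0Y G) (fun A : set G => @setYK G A).

Section Coends.
Variable G : groupType.
Variable H : set G.

Definition Hfinite : {pred pset G} :=
  fun A => `[< exists2 D : set G, finite_set D & A `<=` \bigcup_(g in D) rcoset H g >].

Lemma Hfinite_zmod_closed : zmod_closed Hfinite.
Proof.
split; first by apply/asboolP; exists set0 => // x [].
move=> A B /asboolP[D Df AD] /asboolP[E Ef BE].
apply/asboolP; exists (D `|` E); first by rewrite finite_setU.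
move=> x [[/AD[g Dg gx] _]|[/BE[g Eg gx] _]]; exists g => //; first by left.
by right.
Qed.

HB.instance Definition _ :=
  GRing.isZmodClosed.Build (pset G) Hfinite Hfinite_zmod_closed.

(* The quotient $P(G)/F_H(G)$, with $F_2$ acting by multiples. *)
Definition pset_mod : Type := Quotient.quot Hfinite.

HB.instance Definition _ := GRing.Zmodule.on pset_mod.

Definition pset_cls (A : set G) : pset_mod :=
  (\pi_(Quotient.quot Hfinite) (A : pset G))%qT.

Lemma pset_cls_eq (A B : set G) :
  pset_cls A = pset_cls B <-> (A `+` B : pset G) \in Hfinite.
Proof.
have -> : (A `+` B : pset G) = (A : pset G) - (B : pset G) by [].
by rewrite Quotient.idealrBE; split => [AB|/eqP//]; apply/eqP.
Qed.

Lemma pset_clsP (a : pset_mod) : exists A : set G, a = pset_cls A.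
Proof. by exists (repr a : pset G); rewrite /pset_cls reprK. Qed.

Lemma pset_clsD (A B : set G) : pset_cls (A `+` B) = pset_cls A + pset_cls B.
Proof. exact: (@Quotient.pi_add (pset G) Hfinite A B). Qed.

Lemma pset_cls0 : pset_cls set0 = 0.
Proof.
by apply: (@addrI _ (pset_cls set0)); rewrite addr0 -pset_clsD set0Y.
Qed.

Lemma pset_mod_addrr (a : pset_mod) : a + a = 0.
Proof.
by have [A ->] := pset_clsP a; rewrite -pset_clsD setYK pset_cls0.
Qed.

Definition pset_scale (c : 'F_2) (a : pset_mod) : pset_mod := a *+ c.

Lemma pset_scaleA (c d : 'F_2) (a : pset_mod) :
  pset_scale c (pset_scale d a) = pset_scale (c * d) a.
Proof.
by rewrite /pset_scale; case: c d => -[|[|[]]]// ? [[|[|[]]]// ?].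
Qed.

Lemma pset_scale1 : left_id 1 pset_scale.
Proof. by []. Qed.

Lemma pset_scaleDr : right_distributive pset_scale +%R.
Proof. by move=> c a b; rewrite /pset_scale mulrnDl. Qed.

Lemma pset_scaleDl (a : pset_mod) :
  {morph pset_scale^~ a : c d / c + d}.
Proof.
rewrite /pset_scale => -[[|[|[]]]// ?] [[|[|[]]]// ?] /=; rewrite ?addr0 ?add0r//.
by rewrite pset_mod_addrr.
Qed.

HB.instance Definition _ := GRing.Zmodule_isLmodule.Build 'F_2 pset_mod
  pset_scaleA pset_scale1 pset_scaleDr pset_scaleDl.

(* Right translation on a representative; well defined by [pset_act_cls]. *)
Definition pset_act (a : pset_mod) (g : G) : pset_mod :=
  pset_cls (rcoset (repr a : pset G) g).

Lemma pset_act_cls (A : set G) (g : G) :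
  pset_act (pset_cls A) g = pset_cls (rcoset A g).
Proof.
set B : set G := (repr (pset_cls A) : pset G).
have /pset_cls_eq /asboolP[D Df BD] : pset_cls B = pset_cls A.
  by rewrite /pset_cls /B reprK.
apply/pset_cls_eq/asboolP; exists [set (d * g)%g | d in D].
  exact: finite_image.
have key x : (B `+` A) x ->
    (\bigcup_(h in [set (d * g)%g | d in D]) rcoset H h) (x * g)%g.
  move=> /BD[d Dd [h Hh <-]]; exists (d * g)%g; first by exists d.
  by exists h => //; rewrite mulgA.
move=> _ [[[x Bx <-] nA]|[[x Ax <-] nB]]; apply: key.
  by left; split => // Ax; apply: nA; exists x.
by right; split => // Bx; apply: nB; exists x.
Qed.

Definition pset_fixed : set pset_mod :=
  [set a | forall g : G, pset_act a g = a].

End Coends.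

(* The number of coends, written $\tilde e(G, H)$. *)
Definition coends (R : realType) (G : groupType) (H : set G) : \bar R :=
  subspace_dim R (@pset_fixed G H).

Section Metric.
Variables (R : realType) (X : metricType R).
Implicit Types Y Z C : set X.

(* The distance to the empty set is [+oo], so its neighborhoods are empty. *)
Definition dist_to (Y : set X) (x : X) : \bar R :=
  ereal_inf [set (mdist x y)%:E | y in Y].

Definition nbhd (r : R) Y : set X := [set x | (dist_to Y x <= r%:E)%E].

Definition dHaus Y Z : \bar R :=
  ereal_inf [set r%:E | r in
    [set r : R | [/\ 0 <= r, Y `<=` nbhd r Z & Z `<=` nbhd r Y]]].

Definition complementary_component Z C :=
  exists2 x : X, ~ Z x & C = connected_component (~` Z) x.

Definition shallow Z C := exists2 r : R, 0 <= r & C `<=` nbhd r Z.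

Definition noncrossing (F : set (set X)) :=
  exists2 k : R, 0 < k & forall Y1 Y2, F Y1 -> F Y2 -> Y1 <> Y2 ->
    exists C, [/\ complementary_component Y2 C, ~ shallow Y2 C & Y1 `<=` nbhd k C].

End Metric.

Section QuasiIsometry.
Variables (R : realType) (X Y : metricType R).

Definition quasi_isometry (f : X -> Y) :=
  exists L C : R, [/\ 1 <= L, 0 <= C,
    forall x x', L^-1 * mdist x x' - C <= mdist (f x) (f x') <= L * mdist x x' + C &
    forall y, exists x, mdist y (f x) <= C].

End QuasiIsometry.

Definition quasi_inverse (R : realType) (X Y : metricType R)
    (f : X -> Y) (f' : Y -> X) :=
  quasi_isometry f' /\ exists C : R,
    (forall x, mdist (f' (f x)) x <= C) /\ (forall y, mdist (f (f' y)) y <= C).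

(* [fg_gensP]: no proper subgroup contains the generators. *)
Record fgGroup := FgGroup {
  fg_sort :> groupType;
  fg_gens : seq fg_sort;
  fg_gensP : forall H : set fg_sort,
    subgroup H -> (forall s, s \in fg_gens -> H s) -> H = setT }.

(* The Cayley graph as a metric space. Edges join distinct vertices, and there
   is one edge for each adjacent pair. A point of the geometric realization is
   given by its barycentric coordinates, a function on the vertices. *)
Section Cayley.
Variables (R : realType) (G : fgGroup).

Definition adjacent (g h : G) :=
  g <> h /\ exists2 s : G, s \in fg_gens G \/ (s^-1)%g \in fg_gens G & h = (g * s)%g.

Definition vertex_coord (g : G) : G -> R := fun x => (x == g)%:R.

(* The point at distance [t] from [g] on the edge joining [g] and [h]. *)
Definition edge_coord (g h : G) (t : R) : G -> R :=
  fun x => (1 - t) * vertex_coord g x + t * vertex_coord h x.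

Definition is_point (p : G -> R) :=
  (exists g, p = vertex_coord g) \/
  (exists g h t, [/\ adjacent g h, 0 <= t <= 1 & p = edge_coord g h t]).

Record cayley := Cayley { coord : G -> R; coordP : is_point coord }.

Lemma coord_inj : injective coord.
Proof.
by move=> [p Pp] [q Pq] /= pq; subst q; congr Cayley; exact: Prop_irrelevance.
Qed.

HB.instance Definition _ := gen_eqMixin cayley.
HB.instance Definition _ := gen_choiceMixin cayley.

Definition vertex (g : G) : cayley :=
  @Cayley (vertex_coord g) (or_introl (ex_intro _ g erefl)).

(* [pl_path x y l]: there is a piecewise linear path of length [l] from [x] to
   [y]; each linear piece runs inside one closed edge. *)
Inductive pl_path (x : cayley) : cayley -> R -> Prop :=
| pl_path0 : pl_path x x 0
| pl_pathS y z l g h s t : pl_path x y l ->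
    adjacent g h -> 0 <= s <= 1 -> 0 <= t <= 1 ->
    coord y = edge_coord g h s -> coord z = edge_coord g h t ->
    pl_path x z (l + `|s - t|).

Definition path_dist (x y : cayley) : R := inf [set l | pl_path x y l].

Lemma pl_path_ge0 x y l : pl_path x y l -> 0 <= l.
Proof. by elim=> // *; rewrite addr_ge0. Qed.

Lemma pl_path_cat x y z l m : pl_path x y l -> pl_path y z m -> pl_path x z (l + m).
Proof.
move=> xy; elim=> [|y' z' k g h s t _ IH gh s1 t1 ys zt]; first by rewrite addr0.
by rewrite addrA; apply: (pl_pathS IH gh s1 t1 ys zt).
Qed.

Lemma pl_path_rev x y l : pl_path x y l -> pl_path y x l.
Proof.
elim=> [|y' z' k g h s t _ IH gh s1 t1 ys zt]; first exact: pl_path0.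
rewrite addrC; apply: pl_path_cat IH.
by rewrite -(add0r `|_|) distrC; apply: (pl_pathS (pl_path0 _) gh t1 s1 zt ys).
Qed.

Lemma pl_path_coord x y l a : pl_path x y l -> `|coord x a - coord y a| <= l.
Proof.
elim=> [|y' z' k g h s t _ IH gh s1 t1 ys zt]; first by rewrite subrr normr0.
rewrite (le_trans (ler_distD (coord y' a) _ _))// lerD// ys zt /edge_coord.
set u := vertex_coord g a; set v := vertex_coord h a.
have -> : (1 - s) * u + s * v - ((1 - t) * u + t * v) = (s - t) * (v - u).
  by rewrite !mulrBl !mulrBr !mul1r; lra.
rewrite normrM ler_piMr// /u /v /vertex_coord.
by case: (_ == _); case: (_ == _); rewrite ?subrr ?subr0 ?sub0r ?normrN ?normr0 ?normr1.
Qed.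

Lemma edge_coord0 g h : edge_coord g h 0 = vertex_coord g.
Proof. by apply/funext => x; rewrite /edge_coord subr0 mul1r mul0r addr0. Qed.

Lemma edge_coord1 g h : edge_coord g h 1 = vertex_coord h.
Proof. by apply/funext => x; rewrite /edge_coord subrr mul1r mul0r add0r. Qed.

Lemma pl_path_vertex g h : exists l, pl_path (vertex g) (vertex h) l.
Proof.
pose H : set G := [set k | forall a, exists l, pl_path (vertex a) (vertex (a * k)%g) l].
suff HT : H = setT.
  have : H (g^-1 * h)%g by rewrite HT.
  by move=> /(_ g); rewrite mulgA mulgV mul1g.
apply: fg_gensP.
  split.
  - by move=> a; exists 0; rewrite mulg1; exact: pl_path0.
  - move=> x y Hx Hy a; have [l xl] := Hx a; have [m ym] := Hy (a * x)%g.
    by exists (l + m); rewrite mulgA; apply: pl_path_cat xl ym.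
  - move=> x Hx a; have [l xl] := Hx (a * x^-1)%g.
    by exists l; apply: pl_path_rev; rewrite mulgVK in xl.
move=> s sG a; have [as_|as_] := pselect (a = a * s)%g.
  by exists 0; rewrite -as_; exact: pl_path0.
exists (0 + `|0 - 1|).
apply: (@pl_pathS _ (vertex a) _ 0 a (a * s)%g); rewrite ?lexx ?ler01//=.
- exact: pl_path0.
- by split => //; exists s => //; left.
- by rewrite edge_coord0.
- by rewrite edge_coord1.
Qed.

Lemma pl_path_to_vertex x : exists g l, pl_path x (vertex g) l.
Proof.
case: (coordP x) => [[g xg]|[g [h [t [gh t1 xt]]]]]; exists g.
  exists 0; suff -> : x = vertex g by exact: pl_path0.
  exact: coord_inj.
exists (0 + `|t - 0|).
apply: (pl_pathS (pl_path0 _) gh t1 _ xt); rewrite ?lexx ?ler01//=.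
by rewrite edge_coord0.
Qed.

Lemma pl_path_exists x y : exists l, pl_path x y l.
Proof.
have [g [l xg]] := pl_path_to_vertex x; have [h [m yh]] := pl_path_to_vertex y.
have [n gh] := pl_path_vertex g h.
by exists (l + (n + m)); apply: pl_path_cat xg (pl_path_cat gh (pl_path_rev yh)).
Qed.

Let has_inf_path x y : has_inf [set l | pl_path x y l].
Proof.
by split; [exact: pl_path_exists|exists 0 => l /pl_path_ge0].
Qed.

Let path_dist_ub x y l : pl_path x y l -> path_dist x y <= l.
Proof. by move=> xy; apply: ge_inf => //; case: (has_inf_path x y). Qed.

Let path_dist_ge0 x y : 0 <= path_dist x y.
Proof.
by apply: lb_le_inf; [exact: pl_path_exists|move=> l /pl_path_ge0].
Qed.

Lemma path_distxx x : path_dist x x = 0.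
Proof.
by apply/eqP; rewrite eq_le path_dist_ge0 andbT path_dist_ub//; exact: pl_path0.
Qed.

Lemma path_dist_positivity x y : path_dist x y = 0 -> x = y.
Proof.
move=> xy0; apply/coord_inj/funext => a; apply/eqP.
rewrite -subr_eq0 -normr_le0 -xy0.
by apply: lb_le_inf; [exact: pl_path_exists|move=> l /pl_path_coord].
Qed.

Lemma path_dist_sym x y : path_dist x y = path_dist y x.
Proof.
by congr inf; apply/seteqP; split => l /pl_path_rev.
Qed.

Lemma path_dist_triangle y x z : path_dist x z <= path_dist x y + path_dist y z.
Proof.
rewrite -lerBlDr; apply: lb_le_inf; first exact: pl_path_exists.
move=> l xy; rewrite lerBlDr -lerBlDl.
apply: lb_le_inf; first exact: pl_path_exists.
by move=> m yz; rewrite lerBlDl path_dist_ub//; exact: pl_path_cat xy yz.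
Qed.

HB.instance Definition _ := @isMetric.Build R cayley
  path_dist path_distxx path_dist_positivity path_dist_sym path_dist_triangle.

Lemma is_point_translate (k : G) (p : G -> R) :
  is_point p -> is_point (fun x => p (k^-1 * x)%g).
Proof.
have eqk g x : (k^-1 * x == g)%g = (x == k * g)%g.
  by apply/eqP/eqP => [<-|->]; rewrite ?mulVKg ?mulKg.
move=> [[g ->]|[g [h [t [[gh [s sG hs]] t1 ->]]]]].
  by left; exists (k * g)%g; apply/funext => x; rewrite /vertex_coord eqk.
right; exists (k * g)%g, (k * h)%g, t; split => //.
  split; first by move=> /mulgI.
  by exists s => //; rewrite hs mulgA.
by apply/funext => x; rewrite /edge_coord /vertex_coord !eqk.
Qed.

(* The left action of [G]; it sends [vertex g] to [vertex (k * g)]. *)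
Definition translate (k : G) (x : cayley) : cayley :=
  Cayley (is_point_translate k (coordP x)).

Lemma translate_vertex k g : translate k (vertex g) = vertex (k * g)%g.
Proof.
apply/coord_inj/funext => x /=; rewrite /vertex_coord; congr (_%:R).
by congr nat_of_bool; apply/eqP/eqP => [<-|->]; rewrite ?mulVKg ?mulKg.
Qed.

End Cayley.

Definition vertices (R : realType) (G : fgGroup) (A : set G) :
    set (cayley R G) :=
  @vertex R G @` A.

Definition noncrossing_subset (R : realType) (G : fgGroup) (Y : set (cayley R G)) :=
  noncrossing [set translate g @` Y | g in [set: G]].

(* Main.v *)
(* The hypotheses on coends give, for every s, three chain-connected subsets of G
   at distance more than s from H, which come close to all of H and lie in three
   disjoint sets B_i whose coboundary is near H: a component of the complement of
   a neighborhood of H that is not near H is stabilized by a finite index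
   subgroup of H, since its frontier is finite modulo its stabilizer K and
   coends(G, K) = 1 excludes infinite index. This is a coarse property, hence H'
   inherits it from H.

   For c in Comm(H) and a vertex g close to f(c), put phi(x) = g^-1 f(c x). Fix
   points u_i, one in each of the three sets, far from H. Suppose that the values
   of two such maps phi, phi' at the u_i are close. Then the neighborhoods Y, Y'
   of phi(H), phi'(H) are parallel. Indeed let E, E' be the components of the
   complements of Y, Y' such that Y' is near E and Y near E'. At most one phi(u_i)
   is in E and at most one phi'(u_i) in E', so some i avoids both. The image under
   phi' of the i-th set avoids E' and is far from Y', hence it avoids Y and lies
   in a component of the complement of Y other than E. Every point of phi'(H) is
   close to that component and to E, hence to Y.

   The phi(u_i) are bounded independently of c, so up to parallelism there are
   finitely many pairs (g, c), and if (g, c), (g0, c0) are parallel then g g0^-1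
   is in Comm(H'). Hence f(Comm(H)) is near Comm(H'); the other inclusion is the
   same statement for the quasi-inverse. *)
Require Import Defs.
From mathcomp Require Import all_boot all_order all_algebra.
From mathcomp Require Import all_classical all_reals all_analysis.
From mathcomp Require Import lra.

Set Implicit Arguments.
Unset Strict Implicit.
Unset Printing Implicit Defensive.

Import Order.TTheory GRing.Theory Num.Theory numFieldNormedType.Exports.

Local Open Scope classical_set_scope.
Local Open Scope ring_scope.

(** * Connectedness and distances in the Cayley graph *)

Lemma nbhd_near (R : realType) (X : metricType R) (Y : set X) (r r' : R) (x : X) :
  r < r' -> nbhd r Y x -> exists2 y, Y y & mdist x y < r'.
Proof.
move=> rr'; rewrite /nbhd /dist_to /= => le_r.
have : (ereal_inf [set (mdist x y)%:E | y in Y] < r'%:E)%E.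
  by rewrite (le_lt_trans le_r)// lte_fin.
by move=> /ereal_inf_lt[_ [y Yy <-]]; rewrite lte_fin => xy; exists y.
Qed.

Lemma near_nbhd (R : realType) (X : metricType R) (Y : set X) (r : R) (x y : X) :
  Y y -> mdist x y <= r -> nbhd r Y x.
Proof.
move=> Yy xy; rewrite /nbhd /dist_to /=.
apply: (@le_trans _ _ (mdist x y)%:E); last by rewrite lee_fin.
by apply: ereal_inf_lbound; exists y.
Qed.

Lemma dHaus_fin (R : realType) (X : metricType R) (Y Z : set X) :
  (dHaus Y Z < +oo)%E -> exists r : R, [/\ 0 <= r,
    forall y, Y y -> exists2 z, Z z & mdist y z <= r &
    forall z, Z z -> exists2 y, Y y & mdist z y <= r].
Proof.
move=> /ereal_inf_lt[_ [r [r0 YZ ZY] <-] _].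
exists (r + 1); split; first by rewrite addr_ge0.
- move=> y /YZ /(@nbhd_near _ _ _ _ (r + 1))[|z Zz yz]; first by rewrite ltrDl.
  by exists z => //; exact: ltW.
- move=> z /ZY /(@nbhd_near _ _ _ _ (r + 1))[|y Yy yz]; first by rewrite ltrDl.
  by exists y => //; exact: ltW.
Qed.

Lemma fin_dHaus (R : realType) (X : metricType R) (Y Z : set X) (r s : R) :
  (forall y, Y y -> exists2 z, Z z & mdist y z <= r) ->
  (forall z, Z z -> exists2 y, Y y & mdist z y <= s) ->
  (dHaus Y Z < +oo)%E.
Proof.
move=> YZ ZY; pose t := Num.max 0 (Num.max r s).
apply: (@le_lt_trans _ _ t%:E); last by rewrite ltry.
apply: ereal_inf_lbound; exists t => //; split; first by rewrite le_max lexx.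
- move=> y /YZ[z Zz yz]; apply: (near_nbhd Zz).
  by rewrite (le_trans yz)// !le_max lexx orbT.
- move=> z /ZY[y Yy zy]; apply: (near_nbhd Yy).
  by rewrite (le_trans zy)// !le_max lexx !orbT.
Qed.

(** Within [A], the set where [P] holds and its complement are both cut out by open unions of
    [e]-balls, hence clopen. For the complement the hypothesis is used with [x] and [y]
    exchanged. *)
Lemma connected_locally_constant (R : realType) (X : metricType R)
    (A : set X) (P : X -> Prop) (e : R) (a b : X) : connected A -> 0 < e ->
  (forall x y, A x -> A y -> mdist x y < e -> P x -> P y) ->
  A a -> A b -> P a -> P b.
Proof.
move=> Ac e0 PP Aa Ab Pa.
have opn (Q : set X) : (forall x y, A x -> A y -> mdist x y < e -> Q x -> Q y) ->
    exists2 C, open C & A `&` Q = A `&` C.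
  move=> QQ; exists (\bigcup_(x in A `&` Q) (ball x e)^°).
    by apply: bigcup_open => x _; exact: open_interior.
  apply/seteqP; split => [x [Ax Qx]|y [Ay [x [Ax Qx]]]].
    by split => //; exists x => //; exact: nbhsx_ballx.
  by move=> /interior_subset; rewrite ballEmdist => xy; split => //; exact: (QQ x).
have : A `&` [set x | P x] = A.
  apply: Ac.
  - by exists a.
  - by have [C oC ?] := opn _ PP; exists C.
  - have [|C oC AC] := opn (~` [set x | P x]).
      by move=> x y Ax Ay xy nPx /= Py; apply: nPx; apply: (PP y x) => //; rewrite metric_sym.
    exists (~` C); first exact: open_closedC.
    apply/seteqP; split => x [Ax].
      by move=> Px; split => // Cx; have [_] : (A `&` ~` [set x | P x]) x by rewrite AC.
    move=> nCx; split => //=; apply: contrapT => nPx; apply: nCx.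
    by have [_] : (A `&` C) x by rewrite -AC.
by move=> APA; have [] : (A `&` [set x | P x]) b by rewrite APA.
Qed.

Section CayleyGeometry.
Variables (R : realType) (G : fgGroup).
Implicit Types (x y z : cayley R G) (g h : G) (A C : set (cayley R G)).

Lemma mdist_le_path x y l : pl_path x y l -> mdist x y <= l.
Proof.
move=> xy; rewrite [mdist x y]/(path_dist x y); apply: ge_inf => //.
by exists 0 => m /pl_path_ge0.
Qed.

Lemma mdist_lt_path x y r : mdist x y < r -> exists2 l, l < r & pl_path x y l.
Proof.
by move=> /(inf_lt (pl_path_exists x y))[l xy lr]; exists l.
Qed.

Lemma pl_path_translate g x y l :
  pl_path x y l -> pl_path (translate g x) (translate g y) l.
Proof.
elim=> [|y' z' k a b s t _ IH [ab [u us ub]] s1 t1 ys zt]; first exact: pl_path0.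
have tr (w : cayley R G) (r : R) : Defs.coord w = edge_coord a b r ->
    Defs.coord (translate g w) = edge_coord (g * a)%g (g * b)%g r.
  move=> /= ->; apply/funext => v; rewrite /edge_coord /vertex_coord.
  have E c : (g^-1 * v == c)%g = (v == g * c)%g.
    by apply/eqP/eqP => [<-|->]; rewrite ?mulVKg ?mulKg.
  by rewrite !E.
apply: (pl_pathS IH _ s1 t1 (tr _ _ ys) (tr _ _ zt)).
by split; [move=> /mulgI|exists u => //; rewrite ub mulgA].
Qed.

Lemma translate1 x : translate 1 x = x.
Proof.
apply/(@coord_inj R G)/funext => v /=.
by congr (Defs.coord x _); rewrite invg1 mul1g.
Qed.

Lemma translateM g h x : translate g (translate h x) = translate (g * h) x.
Proof.
by apply/(@coord_inj R G)/funext => v /=; rewrite invgM mulgA.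
Qed.

Lemma mdist_translate g x y : mdist (translate g x) (translate g y) = mdist x y.
Proof.
have le h a b : mdist (translate h a) (translate h b) <= mdist a b :> R.
  apply/ler_addgt0Pl => e e0; rewrite addrC.
  have [|l le ab] := @mdist_lt_path a b (mdist a b + e); first by rewrite ltrDl.
  by rewrite (le_trans (mdist_le_path (pl_path_translate h ab)))// ltW.
apply/eqP; rewrite eq_le le /=.
by rewrite -{1}[x]translate1 -{1}[y]translate1 -(mulVg g) -!translateM le.
Qed.

Lemma translate_nbhd g (r : R) A :
  translate g @` nbhd r A = nbhd r (translate g @` A).
Proof.
have D h B x : dist_to (translate h @` B) (translate h x) = dist_to B x.
  rewrite /dist_to; congr ereal_inf; apply/seteqP; split => [_ [_ [b Bb <-] <-]|].
    by exists b => //; rewrite mdist_translate.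
  by move=> _ [b Bb <-]; exists (translate h b); [exists b|rewrite mdist_translate].
apply/seteqP; split => [_ [x Ax <-]|x Ax]; first by rewrite /nbhd /= D.
exists (translate g^-1 x); last by rewrite translateM mulgV translate1.
by rewrite /nbhd /= -(D g) translateM mulgV translate1.
Qed.

Lemma adjacent_segment g h (s t : R) x y : Defs.adjacent g h -> 0 <= s <= 1 -> 0 <= t <= 1 ->
  Defs.coord x = edge_coord g h s -> Defs.coord y = edge_coord g h t ->
  exists2 E : set (cayley R G), connected E &
    [/\ E x, E y & forall z, E z -> mdist x z <= `|s - t|].
Proof.
move=> gh s1 t1 xs yt.
(* The parameter is clamped to [[0, 1]], so that the edge gets a 1-Lipschitz parametrization defined
   on all of [R]. *)
have cl (r : R) : 0 <= Num.max 0 (Num.min 1 r) <= 1.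
  by rewrite le_max lexx ge_max ler01 ge_min lexx.
have cl_id (r : R) : 0 <= r <= 1 -> Num.max 0 (Num.min 1 r) = r.
  by move=> /andP[r0 r1]; rewrite (min_idPr r1) (max_idPr r0).
have clL (a b : R) : `|Num.max 0 (Num.min 1 a) - Num.max 0 (Num.min 1 b)| <= `|a - b|.
  have ab : a - b <= `|a - b| := ler_norm _.
  have ba : b - a <= `|a - b| by rewrite distrC ler_norm.
  rewrite ler_norml !maxEle !minEle; apply/andP; split;
    case: (lerP 1 a) => ?; case: (lerP 1 b) => ?; rewrite ?ler01;
    case: (lerP 0 a) => ?; case: (lerP 0 b) => ?; lra.
have pt (r : R) : is_point (edge_coord g h (Num.max 0 (Num.min 1 r))).
  by right; exists g, h, (Num.max 0 (Num.min 1 r)); split.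
pose e (r : R) := Cayley (pt r).
have eL (a b : R) : mdist (e a) (e b) <= `|a - b|.
  apply: le_trans (clL a b); rewrite -[leRHS]add0r.
  apply: mdist_le_path.
  exact: (pl_pathS (pl_path0 _) gh (cl a) (cl b)).
have ec : continuous e.
  move=> a; apply/cvg_ballP => eps eps0.
  near=> b; rewrite ballEmdist /=; apply: (le_lt_trans (eL _ _)).
  near: b; exact: (@cvgr_dist_lt _ R^o).
have ex : e s = x by apply: coord_inj; rewrite /= cl_id.
have ey : e t = y by apply: coord_inj; rewrite /= cl_id.
exists (e @` `[Num.min s t, Num.max s t]).
  apply: connected_continuous_connected; first exact: segment_connected.
  by apply: continuous_subspaceT.
split.
- by exists s => //=; rewrite in_itv /= ge_min le_max !lexx.
- by exists t => //=; rewrite in_itv /= ge_min le_max !lexx !orbT.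
- move=> _ [a /= ain <-]; rewrite -ex (le_trans (eL _ _))//.
  move: ain; rewrite in_itv /= ge_min le_max => /andP[].
  have st : s - t <= `|s - t| := ler_norm _.
  have ts : t - s <= `|s - t| by rewrite distrC ler_norm.
  by move=> /orP[?|?] /orP[?|?]; rewrite ler_norml; apply/andP; split; lra.
Unshelve. all: by end_near. Qed.

Lemma connected_path x y r : mdist x y < r ->
  exists2 E : set (cayley R G), connected E &
    [/\ E x, E y & forall z, E z -> mdist x z < r].
Proof.
move=> /mdist_lt_path[l lr xy].
suff [E Ec [Ex Ey El]] : exists2 E : set (cayley R G), connected E &
    [/\ E x, E y & forall z, E z -> mdist x z <= l].
  by exists E => //; split => // z /El /le_lt_trans; exact.
elim: xy {lr} => [|y' z' k g h s t xy' [E Ec [Ex Ey El]] gh s1 t1 ys zt].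
  by exists [set x]; [exact: connected1|split => // _ ->; rewrite mdistxx].
have [F Fc [Fy Fz Fl]] := adjacent_segment gh s1 t1 ys zt.
exists (E `|` F); first by apply: connectedU => //; exists y'.
split; [by left|by right|move=> z [/El|/Fl] H].
  by rewrite (le_trans H)// lerDl.
by rewrite (le_trans (metric_triangle _ y' _))// lerD// mdist_le_path.
Qed.

(** A connected set within [k + 1] of [x] joins [x] to a point of [C]; if it missed [Y], it would
    put [x] into [C]. The extra 1 is there because the distance in [nbhd] is an infimum. *)
Lemma component_crossing (Y C : set (cayley R G)) x k :
  complementary_component Y C -> ~ C x -> nbhd k C x ->
  exists2 y, Y y & mdist x y < k + 1.
Proof.
move=> [c0 Yc0 ->] nCx /(@nbhd_near _ _ _ _ (k + 1))[|c Cc xc]; first by rewrite ltrDl.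
have [E Ec [Ex Ecc Ek]] := connected_path xc.
apply: contrapT => nY; apply: nCx.
apply: (connected_component_trans Cc); apply: connected_component_sym.
exists E => //; split => //; first by move=> z Ez Yz; apply: nY; exists z => //; exact: Ek.
Qed.

End CayleyGeometry.

(** * The word metric and commensurators *)

Lemma finite_uniform_bound (R : realType) (T : choiceType) (F : set T)
    (P : T -> R -> Prop) : finite_set F ->
  (forall z r r', r <= r' -> P z r -> P z r') ->
  (forall z, F z -> exists r, P z r) -> exists r, forall z, F z -> P z r.
Proof.
move=> /finite_seqP[s ->] mono; elim: s => [|a s IH] ex; first by exists 0.
have [|r Pr] := IH; first by move=> z zs; apply: ex; rewrite /= inE zs orbT.
have [|q Pq] := ex a; first by rewrite /= inE eqxx.
exists (Num.max r q) => z; rewrite /= inE => /orP[/eqP->|zs].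
  by apply: mono Pq; rewrite le_max lexx orbT.
by apply: (mono _ r); [rewrite le_max lexx|exact: Pr].
Qed.

Section WordMetric.
Variables (R : realType) (G : fgGroup).
Implicit Types (g h k s x y : G) (r l : R).

Definition wdist g h : R := mdist (vertex R g) (vertex R h).

Lemma wdistxx g : wdist g g = 0.
Proof. exact: mdistxx. Qed.

Lemma wdistC g h : wdist g h = wdist h g.
Proof. exact: metric_sym. Qed.

Lemma wdist_triangle h g k : wdist g k <= wdist g h + wdist h k.
Proof. exact: metric_triangle. Qed.

Lemma wdist_mull k g h : wdist (k * g) (k * h) = wdist g h.
Proof. by rewrite /wdist -!translate_vertex mdist_translate. Qed.

Lemma wdistV1 g : wdist g^-1 1 = wdist g 1.
Proof. by rewrite -(wdist_mull g) mulgV mulg1 wdistC. Qed.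

Lemma wdist_mulr g h : wdist (g * h) g = wdist h 1.
Proof. by rewrite -[X in wdist _ X]mulg1 wdist_mull. Qed.

Definition step : set G :=
  [set s | [\/ s = 1%g, s \in fg_gens G | (s^-1)%g \in fg_gens G]].

Lemma stepV s : step s -> step s^-1%g.
Proof.
by move=> [->|sG|sG]; [rewrite invg1; constructor 1|constructor 3; rewrite invgK|constructor 2].
Qed.

Lemma finite_step : finite_set step.
Proof.
apply: (@sub_finite_set _ _ ([set 1%g] `|` ([set` fg_gens G] `|`
    [set (s^-1)%g | s in [set` fg_gens G]]))).
  move=> s [->|sG|sG]; [by left|by right; left|right; right].
  by exists (s^-1)%g; rewrite ?invgK.
rewrite !finite_setU; split; first exact: finite_set1.
by split; [|apply: finite_image]; exact: finite_seq.
Qed.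

Lemma wdist_step g s : step s -> wdist g (g * s) <= 1.
Proof.
move=> sG; have [<-|gs] := pselect (g = g * s)%g; first by rewrite wdistxx.
have -> : 1 = 0 + `|0 - 1| :> R by rewrite add0r sub0r normrN normr1.
apply: mdist_le_path.
apply: (@pl_pathS _ _ _ (vertex R g) _ 0 g (g * s)%g 0 1); rewrite ?lexx ?ler01//=.
- exact: pl_path0.
- split => //; exists s => //; case: sG => [s1|?|?]; [|by left|by right].
  by move: gs; rewrite s1 mulg1.
- by rewrite edge_coord0.
- by rewrite edge_coord1.
Qed.

(** As [step] contains 1, these are the products of at most [n] generators and inverses of
    generators. *)
Fixpoint wball (n : nat) : set G :=
  if n is m.+1 then [set (a * s)%g | a in wball m & s in step] else [set 1%g].

Lemma finite_wball n : finite_set (wball n).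
Proof.
elim: n => [|n IH] /=; first exact: finite_set1.
by apply: finite_image2 => //; exact: finite_step.
Qed.

Lemma wdist_wball n g x : wball n x -> wdist g (g * x) <= n%:R.
Proof.
elim: n x => [|n IH] x /=; first by move=> ->; rewrite mulg1 wdistxx.
move=> [a an [s sG <-]]; rewrite mulgA -natr1.
by rewrite (le_trans (wdist_triangle (g * a) _ _))// lerD ?IH ?wdist_step.
Qed.

(* The slack [1 - Defs.coord y a] makes the estimate propagate along pieces of
   edges whose endpoints are not vertices. *)
Lemma pl_path_wball g (y : cayley R G) l : pl_path (vertex R g) y l ->
  forall a, 0 < Defs.coord y a ->
  exists2 n, wball n (g^-1 * a)%g & n%:R <= l + (1 - Defs.coord y a).
Proof.
elim=> [|y' z k b c s t _ IH [bc [u us cE]] /andP[s0 s1] /andP[t0 t1] ys zt] a.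
  rewrite /= /vertex_coord; have [->|] := eqVneq a g; last by rewrite ltxx.
  by exists 0%N; [rewrite mulVg|rewrite subrr addr0].
have uG : step u by case: us => ?; [constructor 2|constructor 3].
have cb : (c == b) = false by apply/eqP => cb; apply: bc.
have st : s - t <= `|s - t| := ler_norm _.
have ts : t - s <= `|s - t| by rewrite distrC ler_norm.
have yb : Defs.coord y' b = 1 - s.
  by rewrite ys /edge_coord /vertex_coord eqxx eq_sym cb mulr1 mulr0 addr0.
have yc : Defs.coord y' c = s.
  by rewrite ys /edge_coord /vertex_coord eqxx cb mulr1 mulr0 add0r.
rewrite zt /edge_coord /vertex_coord.
have [->|ab] := eqVneq a b.
  rewrite eq_sym cb mulr1 mulr0 addr0 => t1'.
  have [s1'|s1'] := ltP s 1.
    have [|n nb nl] := IH b; first by rewrite yb subr_gt0.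
    by exists n => //; rewrite yb in nl; lra.
  have [|n nc nl] := IH c; first by rewrite yc; lra.
  exists n.+1; last by rewrite -natr1; rewrite yc in nl; lra.
  exists (g^-1 * c)%g => //; exists u^-1%g; first exact: stepV.
  by rewrite cE mulgA mulgK.
have [->|ac] := eqVneq a c; last by rewrite !mulr0 addr0 ltxx.
rewrite mulr1 mulr0 add0r => t0'.
have [s0'|s0'] := ltP 0 s.
  have [|n nc nl] := IH c; first by rewrite yc.
  by exists n => //; rewrite yc in nl; lra.
have [|n nb nl] := IH b; first by rewrite yb; lra.
exists n.+1; last by rewrite -natr1; rewrite yb in nl; lra.
by exists (g^-1 * b)%g => //; exists u; rewrite // -mulgA -cE.
Qed.

Lemma wball_wdist g h r : wdist g h <= r ->
  exists2 n, wball n (g^-1 * h)%g & n%:R <= r + 1.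
Proof.
(* The distance is an infimum of path lengths, which costs 1; the slack in [pl_path_wball] vanishes
   at the vertex [h]. *)
move=> ghr; have [|l lr ghl] := @mdist_lt_path _ _ (vertex R g) (vertex R h) (r + 1).
  by rewrite (le_lt_trans ghr)// ltrDl.
have [|n nh nl] := pl_path_wball ghl (a := h).
  by rewrite /= /vertex_coord eqxx.
by exists n => //; rewrite /= /vertex_coord eqxx subrr addr0 in nl; lra.
Qed.

Lemma finite_ball r : finite_set [set g | wdist 1 g <= r].
Proof.
have [n rn] : exists n : nat, r + 1 < n%:R.
  by exists (Num.truncn (r + 1)).+1; exact: truncnS_gt.
apply: (@sub_finite_set _ _ (\bigcup_(i in `I_n) wball i)).
  move=> g /wball_wdist[m]; rewrite invg1 mul1g => mg mr; exists m => //=.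
  by rewrite -(ltr_nat R) (le_lt_trans mr).
by apply: bigcup_finite => // i _; exact: finite_wball.
Qed.

Definition tube (H : set G) r : set G := [set x | exists2 h, H h & wdist x h <= r].

Lemma tube_le (H : set G) r r' : r <= r' -> tube H r `<=` tube H r'.
Proof. by move=> rr' x [h Hh xh]; exists h => //; exact: le_trans rr'. Qed.

Lemma tube_trans (H : set G) r l x y : wdist x y <= l -> tube H r y -> tube H (l + r) x.
Proof.
by move=> xy [h Hh yh]; exists h => //; rewrite (le_trans (wdist_triangle y _ _))// lerD.
Qed.

Lemma tube_mull (H : set G) r k x : subgroup H -> H k -> tube H r x -> tube H r (k * x)%g.
Proof.
by move=> [_ HM _] Hk [h Hh xh]; exists (k * h)%g; [exact: HM|rewrite wdist_mull].
Qed.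

(** A coset [H g] lies within the length of [g] of [H]. Conversely, [x] near [h] lies in the coset
    of [h^-1 * x], which ranges over a finite ball. *)
Lemma HfiniteP (H A : set G) : (A : Defs.pset G) \in Hfinite H <-> exists r, A `<=` tube H r.
Proof.
split=> [/asboolP[D Df AD]|[r Ar]].
  have [||r Dr] := @finite_uniform_bound R _ D (fun g r => wdist g 1 <= r) Df.
  - by move=> z r r' rr' /le_trans; exact.
  - by move=> z _; exists (wdist z 1).
  exists r => x /AD[g Dg [h Hh <-]]; exists h => //.
  by rewrite wdist_mulr; exact: Dr.
apply/asboolP; exists [set g | wdist 1 g <= r]; first exact: finite_ball.
move=> x /Ar[h Hh xh]; exists (h^-1 * x)%g => /=.
  by rewrite -(wdist_mull h) mulg1 mulVKg wdistC.
by exists h => //; rewrite mulVKg.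
Qed.

(** * Commensurability in terms of tubes *)

Section Commensurator.
Variable H : set G.
Hypothesis sH : subgroup H.

Let H1 : H 1%g. Proof. by case: sH. Qed.
Let HM x y : H x -> H y -> H (x * y)%g. Proof. by case: sH => _ + _; exact. Qed.
Let HV x : H x -> H x^-1%g. Proof. by case: sH => _ _; exact. Qed.

(** The finitely many left cosets have representatives of bounded length. Inverting [x^-1 = h k]
    gives [x = k^-1 h^-1], which the left-invariant metric places within the length of [h] of
    [k^-1]. *)
Lemma finite_index_tube (K : set G) (A : set G) :
  subgroup K -> (forall x, A x -> A x^-1%g) -> finite_index K A ->
  exists r, A `<=` tube K r.
Proof.
move=> [K1 KM KV] AV Kf.
have [||r Pr] := @finite_uniform_bound R _ _
  (fun B r => exists2 h, B = lcoset h K & wdist h 1 <= r) Kf.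
- by move=> B r r' rr' [h -> hr]; exists h => //; exact: le_trans rr'.
- by move=> _ [h Ah <-]; exists (wdist h 1), h.
- exists r => x Ax; have [|h E hr] := Pr (lcoset x^-1 K); first by exists x^-1%g => //; exact: AV.
  have [k Kk kx] : lcoset h K x^-1%g by rewrite -E; exists 1%g; rewrite ?mulg1.
  exists k^-1%g; first exact: KV.
  rewrite -[x]invgK -kx invgM -{2}[k^-1%g]mulg1 wdist_mull.
  by rewrite wdistV1.
Qed.

(* [E h b] may be read as: [b] labels the right coset of [h^-1]. *)
Lemma finite_index_labels (T : choiceType) (K A : set G) (F : set T) (E : G -> T -> Prop) :
  subgroup K -> finite_set F ->
  (forall h, A h -> exists2 b, F b & E h b) ->
  (forall h h' b, A h -> A h' -> E h b -> E h' b -> K (h^-1 * h')%g) ->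
  finite_index K A.
Proof.
move=> [K1 KM KV] Ff AF EK.
(* One representative is chosen per label, with default 1 for labels that do not occur; elements
   with equal labels have the same coset. *)
apply: (@sub_finite_set _ _ [set lcoset (xget 1%g [set h | A h /\ E h b]) K | b in F]).
  move=> _ [h Ah <-]; have [b Fb hb] := AF h Ah; exists b => //.
  case: xgetP => [h' _ [Ah' hb']|/(_ h)]; last by move=> /(_ (conj Ah hb)).
  apply/seteqP; split => _ [k Kk <-].
    exists (h^-1 * h' * k)%g; first by apply: KM => //; exact: EK hb hb'.
    by rewrite mulgA mulVKg.
  exists (h'^-1 * h * k)%g; first by apply: KM => //; exact: EK hb' hb.
  by rewrite mulgA mulVKg.
exact: finite_image.
Qed.

Lemma subgroupIJ c : subgroup (H `&` [set (h ^ c)%g | h in H]).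
Proof.
split=> [|x y [Hx [x' Hx' xE]] [Hy [y' Hy' yE]]|x [Hx [x' Hx' xE]]].
- by split => //; exists 1%g => //; rewrite conj1g.
- split; first exact: HM.
  by exists (x' * y')%g; [exact: HM|rewrite conjMg xE yE].
- by split; [exact: HV|exists x'^-1%g; [exact: HV|rewrite conjVg xE]].
Qed.

(** [H] and its conjugate are both close to their intersection. An element [k = h' ^ c] of it
    satisfies [c k = h' c], which is within the length of [c] of [h']. *)
Lemma Comm_tube c : Comm H c -> exists r,
  (forall h, H h -> tube H r (c * h)%g) /\
  (forall h, H h -> exists2 h', H h' & wdist h (c * h') <= r).
Proof.
move=> [f1 f2]; have sK := subgroupIJ c.
have [r1 n1] := finite_index_tube sK HV f1.
have [|r2 n2] := finite_index_tube sK _ f2.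
  by move=> _ [h Hh <-]; exists h^-1%g; [exact: HV|rewrite conjVg].
exists (Num.max r1 r2 + wdist c 1); split => h Hh.
- have [k [_ [h' Hh' kE]] hk] := n1 h Hh.
  exists h' => //; rewrite (le_trans (wdist_triangle (c * k) _ _))//.
  rewrite wdist_mull lerD//; first by rewrite le_max hk.
  by rewrite -kE conjgE mulVKg wdist_mulr.
- have [|k [Hk _] hk] := n2 (h ^ c)%g; first by exists h.
  exists k => //; rewrite addrC (le_trans (wdist_triangle (h * c) _ _))//.
  rewrite lerD//; first by rewrite wdistC wdist_mulr.
  by rewrite -(wdist_mull c^-1) mulKg -conjgE le_max hk orbT.
Qed.

(** Converse of [Comm_tube], by pigeonhole: the error [b] ranges over a finite ball, and two
    elements with the same error differ by an element of the intersection. *)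
Lemma tube_Comm a r : (forall h, H h -> tube H r (a * h)%g) ->
  (forall h, H h -> exists2 h', H h' & wdist h (a * h') <= r) -> Comm H a.
Proof.
move=> aH Ha; have sK := subgroupIJ a; split.
- apply: (finite_index_labels sK (finite_ball r) (E := fun h b =>
    exists2 h', H h' & (a * h^-1 = h' * b)%g)).
    move=> h Hh; have [|h' Hh' hh'] := aH h^-1%g; first exact: HV.
    exists (h'^-1 * (a * h^-1))%g => /=.
      by rewrite -(wdist_mull h') mulg1 mulVKg wdistC.
    by exists h' => //; rewrite mulVKg.
  move=> x y b Hx Hy [x' Hx' xE] [y' Hy' yE]; split; first by apply: HM => //; exact: HV.
  exists (x' * y'^-1)%g; first by apply: HM => //; exact: HV.
  have -> : x' = (a * x^-1 * b^-1)%g by rewrite xE mulgK.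
  have -> : y' = (a * y^-1 * b^-1)%g by rewrite yE mulgK.
  by rewrite conjgE !invgM !invgK !mulgA mulVg mul1g !mulgVK.
- apply: (finite_index_labels sK (finite_ball r) (E := fun x b =>
    exists h h', [/\ H h, H h', x = (h ^ a)%g & (h^-1 = a * h' * b)%g])).
    move=> _ [h Hh <-]; have [|h' Hh' hh'] := Ha h^-1%g; first exact: HV.
    exists ((a * h')^-1 * h^-1)%g => /=.
      by rewrite -(wdist_mull (a * h')) mulg1 mulVKg wdistC.
    by exists h, h'; rewrite mulVKg.
  move=> _ _ b _ _ [h [h1 [Hh Hh1 -> hE]]] [k [k1 [Hk Hk1 -> kE]]]; split.
    have -> : h = (a * h1 * b)^-1%g by rewrite -hE invgK.
    have -> : k = (a * k1 * b)^-1%g by rewrite -kE invgK.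
    suff -> : ((((a * h1 * b)^-1 ^ a)^-1 * (a * k1 * b)^-1 ^ a) = h1 * k1^-1)%g.
      by apply: HM => //; exact: HV.
    rewrite -conjVg -conjMg conjgE invgK !invgM !mulgA.
    by rewrite mulVg mul1g mulgK mulgVK.
  exists (h^-1 * k)%g; first by apply: HM => //; exact: HV.
  by rewrite conjMg conjVg.
Qed.

End Commensurator.

End WordMetric.

(** * From coends to coarse separation *)

Section CoarseCoends.
Variables (R : realType) (G : fgGroup).
Implicit Types (H K A B : set G) (g h x y s : G) (r t : R).

Lemma tube_trans_mulr H r g x : tube H r (x * g)%g -> tube H (wdist R g 1 + r) x.
Proof. by apply: tube_trans; rewrite wdistC wdist_mulr. Qed.

Lemma pset_fixedP H A : pset_fixed (pset_cls H A) <->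
  forall g, exists r, forall x, ~ tube H r x -> (A x <-> A (x * g)%g).
Proof.
have rc g x : rcoset A g (x * g)%g <-> A x.
  by split => [[a Aa /mulIg <-]|Ax] //; exists x.
split=> fA g; last first.
  have [r Ar] := fA g; rewrite pset_act_cls; apply/pset_cls_eq/(@HfiniteP R).
  exists (wdist R g 1 + r) => x AgA.
  have : tube H r (x * g^-1)%g.
    apply: contrapT => /Ar; rewrite mulgVK => E.
    have {rc} := rc g (x * g^-1)%g; rewrite mulgVK => rc.
    by case: AgA => -[]; tauto.
  by move=> /tube_trans_mulr; rewrite wdistV1.
have := fA g; rewrite pset_act_cls => /pset_cls_eq/(@HfiniteP R)[r Ar].
exists (wdist R g 1 + r) => x nx; apply: contrapT => nA; apply: nx.
apply: tube_trans_mulr; apply: Ar; rewrite /setY /setD /setU /=; have := rc g x.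
have [Ax|Ax] := pselect (A x); have [Axg|Axg] := pselect (A (x * g)%g); tauto.
Qed.

Lemma pset_cls_eq0 H A : pset_cls H A = 0 <-> exists r, A `<=` tube H r.
Proof.
rewrite -(pset_cls0 H) pset_cls_eq; rewrite setYC set0Y; exact: HfiniteP.
Qed.

Lemma scale_F2 H (c : 'F_2) A :
  c *: pset_cls H A = pset_cls H (if c == 0 then set0 else A).
Proof.
case: c => [[|[|[]]]// ?] /=; rewrite ?pset_cls0 //.
Qed.

(** Otherwise the classes of [A] and of the whole group would be two independent fixed vectors. *)
Lemma coends1_cases K A : coends R K = 1%:E -> pset_fixed (pset_cls K A) ->
  (exists r, A `<=` tube K r) \/ (exists r, ~` A `<=` tube K r).
Proof.
move=> K1 fA; apply: contrapT => /not_orP[nA nAC].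
have fT : pset_fixed (pset_cls K setT) by apply/pset_fixedP => g; exists 0.
pose v (i : 'I_2) := if i == 0 then pset_cls K A else pset_cls K setT.
have : (2%:R%:E <= coends R K)%E.
  apply: ereal_sup_ubound; exists 2%N => //; exists v.
    by move=> i; rewrite /v; case: ifP.
  move=> c; rewrite !big_ord_recl big_ord0 addr0 /v /= !scale_F2 -pset_clsD.
  move=> /pset_cls_eq0[r].
  have [c0|c0] := eqVneq (c ord0) 0; last first.
    rewrite /=; case: ifP => _ AT; exfalso.
      by apply: nA; exists r => x Ax; apply: AT; left; split => // -[].
    by apply: nAC; exists r => x Ax; apply: AT; right; split.
  have [c1|c1] := eqVneq (c (lift ord0 ord0)) 0; last first.
    by move=> /= AT; exfalso; apply: nA; exists r => x Ax; apply: AT; right; split => // -[].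
  move=> _ i; case: (unliftP ord0 i) => [j|] -> //.
  by rewrite (ord1 j).
by rewrite K1 lee_fin (ler_nat R 2 1).
Qed.

(** The standard bilinear form on [F_2^3], with vectors encoded as Boolean triples. *)
Definition dot3 (c s : bool * bool * bool) : bool :=
  (c.1.1 && s.1.1) (+) (c.1.2 && s.1.2) (+) (c.2 && s.2).

(** Two linear equations in three unknowns have a nonzero solution; the seven candidates are tried
    in each case. *)
Lemma dot3_orthogonal (s t : bool * bool * bool) :
  exists c, [/\ c <> (false, false, false), dot3 c s = false & dot3 c t = false].
Proof.
move: s t => [[[] []] []] [[[] []] []];
first [by exists (true, false, false)|by exists (false, true, false)
  |by exists (false, false, true)|by exists (true, true, false)
  |by exists (true, false, true)|by exists (false, true, true)
  |by exists (true, true, true)].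
Qed.

Lemma coends_ge3_indep H : (3%:R%:E <= coends R H)%E ->
  exists2 v : 'I_3 -> pset_mod H, forall i, pset_fixed (v i) & lin_indep v.
Proof.
move=> H3; have : (2%:R%:E < coends R H)%E.
  by apply: lt_le_trans H3; rewrite lte_fin ltr_nat.
move=> /ereal_sup_gt[_ [n [v fv iv] <-]]; rewrite lte_fin ltr_nat => n3.
exists (fun i => v (widen_ord n3 i)) => // c cv i.
(* Only the first three vectors are kept: a relation among them is extended by zero coefficients. *)
have := iv (fun j => if (j < 3)%N then c (inord j) else 0) _ (widen_ord n3 i).
rewrite /= ltn_ord; rewrite inord_val; apply.
rewrite -[RHS]cv (bigID (fun j : 'I_n => (j < 3)%N)) /= [X in _ + X]big1 ?addr0.
  rewrite (big_ord_narrow n3); apply: eq_bigr => j _.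
  by rewrite /= ltn_ord inord_val.
by move=> j /negbTE ->; rewrite scale0r.
Qed.

(** Three independent fixed classes cut [G] into eight atoms, indexed by signatures in [F_2^3]. For
    each [c <> 0] some atom whose signature pairs to 1 with [c] is not near [H], and suitable
    choices of [c] produce three different such atoms. *)
Lemma coends_ge3_atoms H : (3%:R%:E <= coends R H)%E -> exists B : 'I_3 -> set G,
  [/\ forall i j x, B i x -> B j x -> i = j,
      forall i r, ~ B i `<=` tube H r &
      exists t, forall i x s, step s -> ~ tube H t x -> B i x -> B i (x * s)%g].
Proof.
move=> /coends_ge3_indep[v fv iv].
have /choice[A vA] : forall i, exists A, v i = pset_cls H A by move=> i; exact: pset_clsP.
pose sg x := (`[< A (inord 0) x >], `[< A (inord 1) x >], `[< A (inord 2) x >]).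
have atom c : c <> (false, false, false) ->
    exists2 s, dot3 c s = true & forall r, ~ [set x | sg x = s] `<=` tube H r.
  move=> c0; apply: contrapT => nc.
  have [|||r Hr] := @finite_uniform_bound R (bool * bool * bool)%type setT
    (fun (s : bool * bool * bool) r => dot3 c s = true -> [set x | sg x = s] `<=` tube H r).
  - exact: finite_finset.
  - by move=> z r r' rr' zr /zr; move=> /subset_trans; apply; exact: tube_le.
  - move=> s _; have [cs|] := pselect (dot3 c s = true); last by exists 0.
    apply: contrapT => ns; apply: nc; exists s => // r sr; apply: ns.
    by exists r.
  pose C (i : 'I_3) (b : bool) := if (b%:R : 'F_2) == 0 then set0 else A i.
  have CE i b x : C i b x <-> b && `[< A i x >].
    rewrite /C; case: b => /=; last by split.
    by split => [?|/asboolP]; first exact/asboolP.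
  pose d (i : 'I_3) : bool := nth false [:: c.1.1; c.1.2; c.2] i.
  (* The combination with coefficients [c] is covered by the atoms pairing to 1 with [c]. If all of
     these are near [H], its class vanishes and independence kills [c]. *)
  have d0 : forall i, (d i)%:R = 0 :> 'F_2.
    apply: iv; rewrite !big_ord_recl big_ord0 addr0 !vA !scale_F2 -!pset_clsD.
    apply/pset_cls_eq0; exists r => x; rewrite -!/(C _ _) => Cx.
    apply: (Hr (sg x)) => //; rewrite /dot3 /=.
    have -> : inord 0 = ord0 :> 'I_3 by apply: val_inj; rewrite /= inordK.
    have -> : inord 1 = lift ord0 ord0 :> 'I_3 by apply: val_inj; rewrite /= inordK.
    have -> : inord 2 = lift ord0 (lift ord0 ord0) :> 'I_3.
      by apply: val_inj; rewrite /= inordK.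
    move: Cx (CE ord0 (d ord0) x) (CE (lift ord0 ord0) (d (lift ord0 ord0)) x)
      (CE (lift ord0 (lift ord0 ord0)) (d (lift ord0 (lift ord0 ord0))) x).
    rewrite /setY /setD /setU /= /d /=.
    case: (c.1.1 && _); case: (c.1.2 && _); case: (c.2 && _) => /=;
    by intuition.
  apply: c0; have F2 (b : bool) : b%:R = 0 :> 'F_2 -> b = false by case: b.
  have := F2 _ (d0 ord0); have := F2 _ (d0 (lift ord0 ord0)).
  have := F2 _ (d0 (lift ord0 (lift ord0 ord0))); rewrite /d /=.
  by case: (c) => -[? ?] ? /= -> -> ->.
have [|s1 _ a1] := atom (true, false, false) => //.
(* Taking [c] orthogonal to the signatures already found forces the new signature to differ from
   them. *)
have [c2 [c20 c2s1 _]] := dot3_orthogonal s1 s1; have [s2 c2s2 a2] := atom c2 c20.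
have [c3 [c30 c3s1 c3s2]] := dot3_orthogonal s1 s2; have [s3 c3s3 a3] := atom c3 c30.
pose S (i : 'I_3) := nth s1 [:: s1; s2; s3] i.
have Sinj : injective S.
  have n12 : s1 <> s2 by move=> E; move: c2s2; rewrite -E c2s1.
  have n13 : s1 <> s3 by move=> E; move: c3s3; rewrite -E c3s1.
  have n23 : s2 <> s3 by move=> E; move: c3s3; rewrite -E c3s2.
  move=> [[|[|[|//]]] ?] [[|[|[|//]]] ?] /= E; apply: val_inj => //=;
  by move: E; rewrite /S /=; congruence.
exists (fun i => [set x | sg x = S i]); split.
- by move=> i j x /= -> /Sinj.
- by move=> [[|[|[|//]]] ?].
- have fA i : exists t, forall s, step s ->
      forall x, ~ tube H t x -> (A i x <-> A i (x * s)%g).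
    apply: finite_uniform_bound; first exact: finite_step.
      by move=> z r r' rr' zr x nx; apply: zr => /(tube_le rr').
    by move=> s _; have := fv i; rewrite vA => /pset_fixedP; exact.
  have [t0 f0] := fA (inord 0); have [t1 f1] := fA (inord 1).
  have [t2 f2] := fA (inord 2); exists (Num.max t0 (Num.max t1 t2)) => i x s sG nx.
  rewrite /= => <-.
  rewrite /sg; congr (_, _, _); apply: asbool_equiv_eq.
  + by apply: iff_sym; apply: f0 => // h; apply: nx; apply: tube_le h; rewrite le_max lexx.
  + by apply: iff_sym; apply: f1 => // h; apply: nx; apply: tube_le h; rewrite !le_max lexx orbT.
  + by apply: iff_sym; apply: f2 => // h; apply: nx; apply: tube_le h; rewrite !le_max lexx !orbT.
Qed.

End CoarseCoends.

(** The clause on [V] says that [U] is chain-connected from [u] with steps of length [l], stated as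
    an induction principle. The step length [l] is independent of the distance [s]. *)
Definition coarsely_3separates (R : realType) (G : fgGroup) (H : set G) :=
  exists B : 'I_3 -> set G,
  [/\ forall i j x, B i x -> B j x -> i = j,
      forall l : R, exists t : R, forall i x y,
        wdist R x y <= l -> ~ tube H t x -> B i x -> B i y &
      exists l : R, forall (s : R) i, exists (U : set G) (m : R) u,
        [/\ U u, U `<=` B i, forall x, U x -> ~ tube H s x,
            forall V : set G, V u ->
              (forall x y, U x -> U y -> wdist R x y <= l -> V x -> V y) -> U `<=` V &
            forall h, H h -> exists2 x, U x & wdist R h x <= m]].

(** * Components of the complement of a tube *)

Section Components.
Variables (R : realType) (G : fgGroup) (H : set G) (s : R).
Hypotheses (sH : subgroup H) (s0 : 0 <= s).
Implicit Types (a b g h k x y z : G) (r t : R).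

Let H1 : H 1%g. Proof. by case: sH. Qed.
Let HM x y : H x -> H y -> H (x * y)%g. Proof. by case: sH => _ + _; exact. Qed.
Let HV x : H x -> H x^-1%g. Proof. by case: sH => _ _; exact. Qed.

Local Notation far := (fun x => ~ tube H s x).

Inductive far_comp x : G -> Prop :=
| far_comp_refl : far_comp x x
| far_comp_step y a : far_comp x y -> step a -> far (y * a)%g -> far_comp x (y * a)%g.

Lemma far_comp_is_far x y : far x -> far_comp x y -> far y.
Proof. by move=> fx; elim. Qed.

Lemma far_comp_trans y x z : far_comp x y -> far_comp y z -> far_comp x z.
Proof. by move=> xy; elim=> // u a _ IH sa fa; exact: far_comp_step. Qed.

Lemma far_comp_sym x y : far x -> far_comp x y -> far_comp y x.
Proof.
move=> fx xy; elim: xy (xy) => [_|z a xz IH sa fa xza]; first exact: far_comp_refl.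
apply: far_comp_trans (IH xz).
rewrite -{2}[z](mulgK a); apply: far_comp_step; [exact: far_comp_refl|exact: stepV|].
by rewrite mulgK; exact: far_comp_is_far xz.
Qed.

Lemma far_mull h x : H h -> far x -> far (h * x)%g.
Proof. by move=> Hh fx /(tube_mull sH (HV Hh)); rewrite mulKg. Qed.

Lemma far_comp_mull h x y : H h -> far_comp x y -> far_comp (h * x)%g (h * y)%g.
Proof.
move=> Hh; elim=> [|z a _ IH sa fa]; first exact: far_comp_refl.
by rewrite mulgA; apply: far_comp_step => //; rewrite -mulgA; exact: far_mull.
Qed.

(** Walk along a word from [x] to 1, which lies in [H]: the last vertex before the first entry into
    the tube is one step away from it. *)
Lemma far_comp_frontier x : far x -> exists2 y, far_comp x y & tube H (1 + s) y.
Proof.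
move=> fx.
have [n xn _] := @wball_wdist R G x 1%g (wdist R x 1%g) (lexx _).
have walk b : wball n b -> far_comp x (x * b)%g \/ exists2 y, far_comp x y & tube H (1 + s) y.
  elim: n b {xn} => [|n IH] b /=; first by move=> ->; rewrite mulg1; left; exact: far_comp_refl.
  move=> [c cn [a sa <-]]; have [xc|] := IH c cn; last by right.
  have [na|fa] := pselect (tube H s (x * (c * a))%g).
    right; exists (x * c)%g => //; apply: tube_trans na.
    by rewrite mulgA; exact: wdist_step.
  by left; rewrite mulgA; apply: far_comp_step => //; rewrite -mulgA.
case: (walk _ xn) => //; rewrite mulg1 mulgV => x1.
by case: (far_comp_is_far fx x1); exists 1%g => //; rewrite wdistxx.
Qed.

Lemma tube_orbit t y : tube H t y -> exists2 z, wdist R 1%g z <= t & exists2 h, H h & y = (h * z)%g.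
Proof.
move=> [h Hh yh]; exists (h^-1 * y)%g; last by exists h; rewrite ?mulVKg.
by rewrite -(wdist_mull R h) mulg1 mulVKg wdistC.
Qed.

(** By [far_comp_frontier] every component has an [H]-translate meeting a finite ball. Hence the
    shallow components share a bound, and they cannot cover the part of [B] outside the tube up to
    bounded distance. *)
Lemma deep_comp (B : set G) : (forall r, ~ B `<=` tube H r) ->
  exists x, [/\ B x, far x & forall r, ~ far_comp x `<=` tube H r].
Proof.
move=> Bdeep; apply: contrapT => nx.
have [||r Pr] := @finite_uniform_bound R G _
  (fun z r => (exists r', far_comp z `<=` tube H r') -> far_comp z `<=` tube H r)
  (@finite_ball R G (1 + s)).
- by move=> z r r' rr' zr /zr /subset_trans; apply; exact: tube_le.
- move=> z _; have [[r zr]|nr] := pselect (exists r', far_comp z `<=` tube H r'); first by exists r.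
  by exists 0.
apply: (Bdeep (Num.max r s)) => x Bx; apply: contrapT => nrs.
have fx : far x by move=> sx; apply: nrs; apply: tube_le sx; rewrite le_max lexx orbT.
have [r' xr'] : exists r', far_comp x `<=` tube H r'.
  by apply: contrapT => nr'; apply: nx; exists x; split => // q xq; apply: nr'; exists q.
have [y xy /tube_orbit[z zs [h Hh yE]]] := far_comp_frontier fx.
have zx : far_comp z (h^-1 * x)%g.
  by rewrite -[z](mulKg h) -yE; apply: far_comp_mull; [exact: HV|exact: far_comp_sym].
have zr' : far_comp z `<=` tube H r'.
  move=> w zw; rewrite -[w](mulKg h); apply: tube_mull => //; first exact: HV.
  by apply: xr'; apply: (far_comp_trans xy); rewrite yE; exact: far_comp_mull.
apply: nrs; rewrite -[x](mulVKg h); apply: tube_mull => //.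
apply: (@tube_le _ _ _ r); first by rewrite le_max lexx.
by apply: Pr zx; [exact: zs|exists r'].
Qed.

Lemma finite_index_of_tube K r : subgroup K -> H `<=` tube K r -> finite_index K H.
Proof.
move=> sK HK; have [_ KM KV] := sK.
apply: (finite_index_labels sK (@finite_ball R G r)
  (E := fun h b => exists2 k, K k & h^-1%g = (k * b)%g)).
  move=> h /HV/HK[k Kk hk]; exists (k^-1 * h^-1)%g; last by exists k; rewrite ?mulVKg.
  by rewrite /= -(wdist_mull R k) mulg1 mulVKg wdistC.
move=> x y b _ _ [k Kk ->] [k' Kk' /(canRL (@invgK _)) ->].
by rewrite invgM mulgA mulgK; apply: KM => //; exact: KV.
Qed.

(* A deep component [U] is invariant under a finite index subgroup of [H]:
   otherwise the stabilizer [K] of [U] has infinite index, and [U], whose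
   frontier is [K]-finite, contradicts [coends R K = 1]. *)
Lemma deep_comp_dense x :
  (forall K : set G, subgroup K -> K `<=` H -> ~ finite_index K H -> coends R K = 1%:E) ->
  far x -> (forall r, ~ far_comp x `<=` tube H r) ->
  exists m, forall h, H h -> exists2 y, far_comp x y & wdist R h y <= m.
Proof.
move=> H_1 fx deep; set U : set G := far_comp x.
pose K : set G := [set k | H k /\ forall y, U y <-> U (k * y)%g].
have KH : K `<=` H by move=> k [].
have sK : subgroup K.
  split=> [|a b [Ha Ua] [Hb Ub]|a [Ha Ua]]; split; rewrite ?mul1g //.
  - by move=> y; rewrite mul1g.
  - exact: HM.
  - by move=> y; rewrite -mulgA -Ua.
  - exact: HV.
  - by move=> y; rewrite (Ua (a^-1 * y)%g) mulVKg.
(* Components sharing a point coincide, so an element of [H] moving one point of [U] into [U]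
   stabilizes [U]. *)
have Ktr h h' z : H h -> H h' -> U (h * z)%g -> U (h' * z)%g -> K (h' * h^-1)%g.
  move=> Hh Hh' Uz Uz'; have Hk : H (h' * h^-1)%g by apply: HM => //; exact: HV.
  have kz : (h' * z = h' * h^-1 * (h * z))%g by rewrite mulgA mulgVK.
  split=> // y; split=> Uy.
    apply: (far_comp_trans Uz'); rewrite kz; apply: far_comp_mull => //.
    by apply: far_comp_trans Uy; exact: far_comp_sym.
  apply: (far_comp_trans Uz); rewrite -[(h * z)%g](mulKg (h' * h^-1)%g) -kz -[y](mulKg (h' * h^-1)%g).
  apply: far_comp_mull; first exact: HV.
  by apply: far_comp_trans Uy; exact: far_comp_sym.
(* The frontier of [U] meets finitely many [H]-orbits, and by [Ktr] each of them meets [U] inside a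
   single [K]-orbit. *)
have [r frontierK] : exists r, forall y, U y -> tube H (1 + s) y -> tube K r y.
  have [||r Pr] := @finite_uniform_bound R G _
    (fun z r => forall h, H h -> U (h * z)%g -> tube K r (h * z)%g)
    (@finite_ball R G (1 + s)).
  - by move=> z r r' rr' zr h Hh Uh; apply: (tube_le rr'); exact: zr.
  - move=> z _; have [[h Hh Uh]|nh] := pselect (exists2 h, H h & U (h * z)%g); last first.
      by exists 0 => h Hh Uh; exfalso; apply: nh; exists h.
    exists (wdist R (h * z)%g 1%g) => h' Hh' Uh'.
    exists (h' * h^-1)%g; first exact: Ktr Uh Uh'.
    by rewrite -(wdist_mull R (h' * h^-1)%g (h * z)%g) mulg1 mulgA mulgVK.
  by exists r => y Uy /tube_orbit[z zs [h Hh yE]]; rewrite yE; apply: Pr => //; rewrite -yE.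
have [/(@finite_index_tube R _ _ _ sK HV)[r' HK]|nK] := pselect (finite_index K H).
  exists (r' + wdist R 1%g x) => h /HK[k Kk hk]; exists (k * x)%g.
    by have [_ <-] := Kk; exact: far_comp_refl.
  rewrite (le_trans (wdist_triangle R k _ _))// lerD//.
  by rewrite -{1}[k]mulg1 wdist_mull.
exfalso.
have stepK a : step a -> exists t, forall y, ~ tube K t y -> (U y <-> U (y * a)%g).
  move=> sa; exists (1 + Num.max r 0) => y ny.
  have nr : ~ tube K r y.
    by move=> ry; apply: ny; apply: tube_le ry; case: (lerP r 0) => ?; lra.
  split=> [Uy|Uya].
    apply: far_comp_step => // sya; apply: nr; apply: frontierK => //.
    by apply: tube_trans sya; exact: wdist_step.
  have [sy|fy] := pselect (tube H s y); last first.
    rewrite -[y](mulgK a); apply: far_comp_step; [exact: Uya|exact: stepV|by rewrite mulgK].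
  exfalso; apply: ny; apply: (@tube_trans _ _ _ _ _ _ (y * a)%g).
    by rewrite wdist_step.
  apply: (@tube_le _ _ _ r); first by rewrite le_max lexx.
  apply: frontierK => //; apply: tube_trans sy.
  by rewrite wdistC wdist_step.
have fU : pset_fixed (pset_cls K U).
  apply/(@pset_fixedP R) => g.
  pose L : set G := [set g | exists r, forall y, ~ tube K r y -> (U y <-> U (y * g)%g)].
  suff LT : L = setT by have : L g by rewrite LT.
  apply: fg_gensP; last by move=> a aG; apply: stepK; constructor 2.
  split.
  - by exists 0 => y _; rewrite mulg1.
  - move=> a b [ra La] [rb Lb]; exists (Num.max ra (wdist R a 1%g + rb)) => y ny.
    rewrite La; first by rewrite mulgA; apply: Lb => /tube_trans_mulr nb; apply: ny;
      apply: tube_le nb; rewrite le_max lexx orbT.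
    by move=> na; apply: ny; apply: tube_le na; rewrite le_max lexx.
  - move=> a [ra La]; exists (wdist R a 1%g + ra) => y ny.
    rewrite (La (y * a^-1)%g) ?mulgVK// => na; apply: ny.
    by rewrite -(wdistV1 R a); exact: tube_trans_mulr.
(* In the first case [U] would be near [H]. In the second, [H], which is disjoint from [U], is near
   [K], so that [K] has finite index. *)
have [[r' UK]|[r' UK]] := coends1_cases (H_1 K sK KH nK) fU.
  apply: (deep r') => y /UK[k Kk yk]; exists k => //; exact: KH.
apply: nK; apply: (finite_index_of_tube (r := r') sK) => h Hh; apply: UK.
by move=> /(far_comp_is_far fx); apply; exists h => //; rewrite wdistxx.
Qed.

End Components.

Lemma coends_3separates (R : realType) (G : fgGroup) (H : set G) : subgroup H ->
  (3%:R%:E <= coends R H)%E ->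
  (forall K : set G, subgroup K -> K `<=` H -> ~ finite_index K H ->
    coends R K = 1%:E) ->
  coarsely_3separates R H.
Proof.
move=> sH /coends_ge3_atoms[B [Bdisj Bdeep [t Bt]]] H_1; exists B; split=> //.
  move=> l; exists (l + 1 + t) => i x y xyl nx Bx.
  have [n xyn nl] := wball_wdist xyl; rewrite -[y](mulVKg x).
  have walk b m : wball m b -> m%:R <= l + 1 -> B i (x * b)%g.
    elim: m b => [|m IH] b /=; first by move=> ->; rewrite mulg1.
    move=> [c cm [a sa <-]]; rewrite -natr1 => ml.
    have mx : wdist R x (x * c)%g <= m%:R by exact: wdist_wball.
    rewrite mulgA; apply: Bt => //; last by apply: IH => //; lra.
    move=> /(tube_trans mx) tx; apply: nx; apply: tube_le tx; lra.
  exact: walk xyn nl.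
(* Radius at least [t] keeps the component inside [B i], at least [s] makes it far enough, and at
   least 0 makes the tube contain [H]. *)
exists 1 => s i; pose q := Num.max (Num.max s t) 0.
have q0 : 0 <= q by rewrite le_max lexx orbT.
have sq : s <= q by rewrite !le_max lexx.
have tq : t <= q by rewrite !le_max lexx orbT.
have [x [Bx fx deep]] := deep_comp sH q0 (Bdeep i).
have [m Hm] := deep_comp_dense sH q0 H_1 fx deep.
exists (far_comp H q x), m, x; split=> //.
- exact: far_comp_refl.
- move=> y; elim=> // z a xz Bz sa fa; apply: Bt => //.
  by move=> /(tube_le tq); exact: (far_comp_is_far fx xz).
- by move=> y xy /(tube_le sq); exact: (far_comp_is_far fx xy).
- move=> V Vx VV y; elim=> // z a xz Vz sa fa.
  by apply: (VV z) => //; [exact: far_comp_step|exact: wdist_step].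
Qed.

(** * Parallel neighborhoods *)

(** The sets [B i] are pulled back by [b] and the sets [U] pushed forward by [a];
    chain-connectedness passes over by taking preimages of [V]. *)
Lemma coarsely_3separates_transfer (R : realType) (G G' : fgGroup)
    (H : set G) (H' : set G') (a : G -> G') (b : G' -> G) (L C D : R) : 0 <= L ->
  (forall x y, wdist R (a x) (a y) <= L * wdist R x y + C) ->
  (forall x y, wdist R (b x) (b y) <= L * wdist R x y + C) ->
  (forall x, wdist R (b (a x)) x <= C) ->
  (forall y, wdist R (a (b y)) y <= C) ->
  (forall h, H h -> tube H' D (a h)) ->
  (forall h', H' h' -> exists2 h, H h & wdist R h' (a h) <= D) ->
  coarsely_3separates R H -> coarsely_3separates R H'.
Proof.
move=> L0 aL bL ba ab HH' H'H [B [Bdisj Bloc [l BU]]].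
exists (fun i y => B i (b y)); split.
- by move=> i j y; exact: Bdisj.
- move=> q; have [t Bt] := Bloc (L * q + C); exists (L * t + C + C + D) => i x y xy nx.
  apply: Bt; first by rewrite (le_trans (bL _ _))// lerD2r ler_wpM2l.
  move=> [h Hh xh]; apply: nx; have [h' Hh' hh'] := HH' h Hh; exists h' => //.
  apply: (le_trans (wdist_triangle R (a h) _ _)); rewrite lerD//.
  apply: (le_trans (wdist_triangle R (a (b x)) _ _)).
  rewrite addrC lerD//; last by rewrite wdistC.
  by rewrite (le_trans (aL _ _))// lerD2r ler_wpM2l.
- exists (L * l + C) => s i; have [t Bt] := Bloc C.
  (* If [a x] is within [s] of [H'], then [x] is within [q] of [H]. The bound [t] keeps [b (a x)] in
     [B i]. *)
  pose q := L * (s + D) + C + C + C.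
  have [U [m [u [Uu UB Ufar Uc Um]]]] := BU (Num.max q t) i.
  exists (a @` U), (D + (L * m + C)), (a u); split.
  + by exists u.
  + move=> _ [x Ux <-]; apply: (Bt i x); [by rewrite wdistC| |exact: UB].
    by move=> tx; apply: (Ufar x Ux); apply: tube_le tx; rewrite le_max lexx orbT.
  + move=> _ [x Ux <-] [h' Hh' xh']; have [h Hh hh'] := H'H h' Hh'.
    apply: (Ufar x Ux); exists h => //; rewrite le_max; apply/orP; left.
    have e1 := wdist_triangle R (b (a x)) x h.
    have e2 := wdist_triangle R (b (a h)) (b (a x)) h.
    have e3 := ba x; have e4 := ba h; have e5 := bL (a x) (a h).
    have e6 : wdist R (a x) (a h) <= s + D.
      by rewrite (le_trans (wdist_triangle R h' _ _))// lerD.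
    have e7 := ler_wpM2l L0 e6; rewrite wdistC in e3; rewrite /q; lra.
  + move=> V Vu VV _ [x Ux <-]; apply: (Uc (a @^-1` V)) => //= y z Uy Uz yz.
    apply: VV; [by exists y|by exists z|].
    by rewrite (le_trans (aL _ _))// lerD2r ler_wpM2l.
  + move=> h' /H'H[h Hh hh']; have [x Ux hx] := Um h Hh; exists (a x); first by exists x.
    rewrite (le_trans (wdist_triangle R (a h) _ _))// lerD//.
    by rewrite (le_trans (aL _ _))// lerD2r ler_wpM2l.
Qed.

Section Parallel.
Variables (R : realType) (G G' : fgGroup) (H : set G) (L C : R).
Hypothesis L0 : 0 <= L.

Definition coarse_inverses (phi : G -> cayley R G') (psi : cayley R G' -> G) :=
  [/\ forall x y, mdist (phi x) (phi y) <= L * wdist R x y + C,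
      forall p q, wdist R (psi p) (psi q) <= L * mdist p q + C,
      forall x, wdist R (psi (phi x)) x <= C &
      forall p, mdist (phi (psi p)) p <= C].

(** The radius [r] is fixed before [k], which noncrossing supplies for that radius; [u] and [K] are
    then uniform over all pairs of maps. *)
Lemma parallel_of_noncrossing : coarsely_3separates R H -> forall r0 : R,
  exists r : R, [/\ r0 < r, 0 <= r & forall k : R, 0 < k ->
  exists (u : 'I_3 -> G) (K : R), forall phi psi phi' psi',
    coarse_inverses phi psi -> coarse_inverses phi' psi' ->
    (forall i, mdist (phi (u i)) (phi' (u i)) <= 2) ->
    (exists2 E, complementary_component (nbhd r (phi' @` H)) E &
      nbhd r (phi @` H) `<=` nbhd k E) ->
    (exists2 E, complementary_component (nbhd r (phi @` H)) E &
      nbhd r (phi' @` H) `<=` nbhd k E) ->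
    forall h, H h -> exists2 h', H h' & mdist (phi' h) (phi h') <= K].
Proof.
move=> [B [Bdisj Bloc [l BU]]] r0.
have [t Bt] := Bloc (L + C); have [tC BC] := Bloc C.
(* The last term ensures that [psi] sends points outside the [r]-neighborhood of [phi H] outside
   [tube H t], where the sets [B i] are locally constant. *)
pose r := Num.max (Num.max (r0 + 1) 0) (L * t + C + C).
have r0r : r0 + 1 <= r by rewrite !le_max lexx.
have r_ge0 : 0 <= r by rewrite !le_max lexx orbT.
have tr : L * t + C + C <= r by rewrite le_max lexx orbT.
exists r; split=> //; first by rewrite (lt_le_trans _ r0r)// ltrDl.
move=> k k0.
(* [W] exceeds the steps of the image of an [l]-chain and the distance 2 between [phi (u i)] and
   [phi' (u i)]. A path that starts farther than [Q] from [phi' H] and stays within [W] of its start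
   keeps at distance at least [k + r + 2] from [phi' H]. *)
pose W := Num.max (L * l + C + 1) 3.
pose Q := W + k + r + 2.
have WM : L * l + C + 1 <= W by rewrite le_max lexx.
have W3 : 3 <= W by rewrite le_max lexx orbT.
have /choice[U /choice[m0 /choice[u Uu]]] := BU (Num.max (L * Q + C + C + C) tC).
have [|||m Hm] := @finite_uniform_bound R 'I_3 setT
  (fun i m => forall h, H h -> exists2 x, U i x & wdist R h x <= m).
- exact: finite_finset.
- by move=> i m m' mm' ih h /ih[x Ux hx]; exists x => //; exact: le_trans mm'.
- by move=> i _; exists (m0 i); have [] := Uu i.
(* [L * m + C] leads from [phi' h] to [phi' x], the bracket from there to a point of [Y] by
   [component_crossing], and [r + 1] from [Y] to [phi H]. *)
exists u, (L * m + C + (L * m + C + k + 2) + r + 1).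
move=> phi psi phi' psi' ci ci' uu [E' cE' YE'] [E cE YE].
have far p q x y : coarse_inverses p q -> mdist (p x) (p y) <= Q ->
    wdist R x y <= L * Q + C + C + C.
  move=> [_ qL qp _] xyQ.
  have e1 := wdist_triangle R (q (p x)) x y; have e2 := wdist_triangle R (q (p y)) (q (p x)) y.
  have e3 := qp x; have e4 := qp y; have e5 := qL (p x) (p y).
  have e6 := ler_wpM2l L0 xyQ; rewrite wdistC in e3; lra.
have Ufar p q i x h : coarse_inverses p q -> U i x -> H h -> ~ mdist (p x) (p h) <= Q.
  move=> pq Ux Hh /(far _ _ _ _ pq) xh; have [_ _ Uf _ _] := Uu i.
  by apply: (Uf x Ux); exists h; rewrite // le_max xh.
(* The label [B i] is locally constant on a component, so a component contains at most one of the
   three points. *)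
have uniq p q i j (F : set (cayley R G')) : coarse_inverses p q ->
    complementary_component (nbhd r (p @` H)) F -> F (p (u i)) -> F (p (u j)) -> i = j.
  move=> [pL qL qp pq] [c cF FE] Fi Fj.
  have lab n : B n (q (p (u n))).
    have [Un UB Uf _ _] := Uu n; apply: (BC n (u n)); [by rewrite wdistC| |exact: UB].
    by move=> tn; apply: (Uf _ Un); apply: tube_le tn; rewrite le_max lexx orbT.
  apply: (Bdisj i j (q (p (u j)))); last exact: lab.
  have Fc : connected F by rewrite FE; exact: component_connected.
  apply: (@connected_locally_constant _ _ F (fun y => B i (q y)) 1 (p (u i)) (p (u j))) => //.
  move=> x y Fx Fy xy1; apply: Bt.
    rewrite (le_trans (qL _ _))// lerD2r -[leRHS]mulr1 ler_wpM2l//; exact: ltW.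
  have : ~ nbhd r (p @` H) x.
    by move: Fx; rewrite FE => /connected_component_sub.
  move=> nY [h Hh xh]; apply: nY; apply: (@near_nbhd _ _ _ _ _ (p h)); first by exists h.
  apply: le_trans tr; apply: (le_trans (metric_triangle _ (p (q x)) _)).
  rewrite addrC lerD//; last by rewrite metric_sym.
  by rewrite (le_trans (pL _ _))// lerD2r ler_wpM2l.
have [i [nE nE']] : exists i, ~ E (phi (u i)) /\ ~ E' (phi' (u i)).
  apply: contrapT => ni.
  have EE' i : E (phi (u i)) \/ E' (phi' (u i)).
    by have [?|?] := pselect (E (phi (u i))); have [?|?] := pselect (E' (phi' (u i)));
      [left|left|right|case: ni; exists i].
  have U1 i j := @uniq phi psi i j E ci cE.
  have U2 i j := @uniq phi' psi' i j E' ci' cE'.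
  pose i0 : 'I_3 := @Ordinal 3 0 isT; pose i1 : 'I_3 := @Ordinal 3 1 isT.
  pose i2 : 'I_3 := @Ordinal 3 2 isT.
  have n01 : i0 <> i1 by []. have n02 : i0 <> i2 by []. have n12 : i1 <> i2 by [].
  case: (EE' i0) (EE' i1) (EE' i2) => ? [] ? [] ?;
    first [by case: n01; exact: U1|by case: n01; exact: U2|by case: n02; exact: U1
      |by case: n02; exact: U2|by case: n12; exact: U1|by case: n12; exact: U2].
have [Ui _ _ Uc _] := Uu i.
set Y := nbhd r (phi @` H) in cE YE' *; set Y' := nbhd r (phi' @` H) in cE' YE *.
have Yh (p : G -> cayley R G') z : nbhd r (p @` H) z ->
    exists2 h, H h & mdist z (p h) < r + 1.
  move=> zY; have [|_ [h Hh <-] zh] := nbhd_near (_ : r < r + 1) zY.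
    by rewrite ltrDl.
  by exists h.
(* A short path from [phi' x] avoids [Y'], hence stays outside [E']. If it met [Y], which is
   [k]-close to [E'], then [component_crossing] would bring it near [Y']. *)
have join x z : U i x -> connected_component (~` Y') (phi' (u i)) (phi' x) ->
    mdist (phi' x) z < W ->
    connected_component (~` Y') (phi' (u i)) z /\ connected_component (~` Y) (phi' x) z.
  move=> Ux cx /connected_path[P Pc [Px Pz PW]].
  have PQ e h : P e -> H h -> mdist e (phi' h) < k + r + 2 -> False.
    move=> /PW We Hh eh; apply: (Ufar _ _ _ _ _ ci' Ux Hh).
    by rewrite (le_trans (metric_triangle _ e _))// /Q; lra.
  have PY' : P `<=` ~` Y'.
    move=> e Pe /Yh[h Hh eh]; apply: (PQ e h Pe Hh); lra.
  have cP e : P e -> connected_component (~` Y') (phi' (u i)) e.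
    by move=> Pe; apply: (connected_component_trans cx); exists P.
  split; first exact: cP.
  exists P => //; split=> // e Pe Ye.
  have nE'e : ~ E' e.
    move: cE' nE' => [c0 _ ->] nE' ce; apply: nE'; apply: (connected_component_trans ce).
    by apply: connected_component_sym; exact: cP.
  have [y Y'y ey] := component_crossing cE' nE'e (YE' e Ye).
  have [h Hh yh] := Yh _ _ Y'y; apply: (PQ e h Pe Hh).
  by rewrite (le_lt_trans (metric_triangle _ y _))//; lra.
have nY'u : ~ Y' (phi' (u i)).
  move=> /Yh[h Hh uh]; apply: (Ufar _ _ _ _ _ ci' Ui Hh); rewrite /Q; lra.
have cu : connected_component (~` Y') (phi' (u i)) (phi' (u i)).
  exact: connected_component_refl.
have cU : U i `<=` [set x | connected_component (~` Y') (phi' (u i)) (phi' x) /\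
    connected_component (~` Y) (phi (u i)) (phi' x)].
  apply: Uc.
    split=> //; apply: connected_component_sym.
    have [|//] := join _ (phi (u i)) Ui cu.
    by rewrite metric_sym (le_lt_trans (uu i))//; lra.
  move=> x y Ux Uy xy [cx cx']; have [pL _ _ _] := ci'.
  have [|cy cxy] := join x (phi' y) Ux cx.
    rewrite (le_lt_trans (pL _ _))//; have := ler_wpM2l L0 xy; lra.
  by split=> //; exact: connected_component_trans cxy.
move=> h Hh; have [x Ux hx] := Hm i I h Hh.
have [_ cx] := cU x Ux; have [pL _ _ _] := ci'.
have Y'h : Y' (phi' h) by apply: (@near_nbhd _ _ _ _ _ (phi' h)); [exists h|rewrite mdistxx].
have [|c Ec hc] := nbhd_near (_ : k < k + 1) (YE _ Y'h); first by rewrite ltrDl.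
have hx' := pL h x; have Lhx := ler_wpM2l L0 hx.
have nEx : ~ E (phi' x).
  move: cE nE => [c0 _ ->] nE ce; apply: nE; apply: (connected_component_trans ce).
  exact: connected_component_sym.
have Ex : nbhd (L * m + C + k + 1) E (phi' x).
  apply: (near_nbhd Ec); rewrite (le_trans (metric_triangle _ (phi' h) _))// metric_sym; lra.
have [y Yy xy] := component_crossing cE nEx Ex.
have [h' Hh' yh'] := Yh _ _ Yy; exists h' => //.
have e1 := metric_triangle (phi' h) (phi' x) (phi h').
have e2 := metric_triangle (phi' x) y (phi h').
lra.
Qed.

End Parallel.

(** * Commensurators under quasi-isometries *)

Lemma vertex_near (R : realType) (G : fgGroup) (x : cayley R G) :
  exists g, mdist x (vertex R g) <= 1.
Proof.
case: (coordP x) => [[g xg]|[g [h [t [gh t1 xt]]]]]; exists g.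
  suff -> : x = vertex R g by rewrite mdistxx.
  exact: coord_inj.
apply: (@le_trans _ _ (0 + `|t - 0|)).
  apply: mdist_le_path.
  apply: (pl_pathS (pl_path0 _) gh t1 _ xt); rewrite ?lexx ?ler01//=.
  by rewrite edge_coord0.
by case/andP: t1 => t0 t1; rewrite subr0 add0r ger0_norm.
Qed.

Section OneDirection.
Variables (R : realType) (G G' : fgGroup).
Variables (f : cayley R G -> cayley R G') (f' : cayley R G' -> cayley R G).
Variables (H : set G) (H' : set G') (L C D R0 : R).
Hypotheses (L0 : 0 <= L) (sH : subgroup H) (sH' : subgroup H').
Hypotheses (fL : forall x y, mdist (f x) (f y) <= L * mdist x y + C)
  (f'L : forall x y, mdist (f' x) (f' y) <= L * mdist x y + C)
  (f'f : forall x, mdist (f' (f x)) x <= C)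
  (ff' : forall y, mdist (f (f' y)) y <= C)
  (fH : forall h, H h -> exists2 h', H' h' & mdist (f (vertex R h)) (vertex R h') <= D)
  (H'f : forall h', H' h' -> exists2 h, H h & mdist (vertex R h') (f (vertex R h)) <= D).
Hypothesis nc : forall r : R, R0 < r ->
  noncrossing [set translate g' @` nbhd r (f @` vertices (lcoset c H))
              | g' in [set: G'] & c in Comm H].

Let Lpos (a b : R) : a <= b -> L * a + C <= L * b + C.
Proof. by move=> ab; rewrite lerD2r ler_wpM2l. Qed.

Let phi (g : G') (c x : G) := translate g^-1%g (f (vertex R (c * x)%g)).

Lemma translate_nbhd_phi (g : G') (c : G) (r : R) :
  translate g^-1%g @` nbhd r (f @` vertices (lcoset c H)) = nbhd r (phi g c @` H).
Proof.
rewrite translate_nbhd; congr nbhd; apply/seteqP; split.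
  by move=> _ [_ [_ [_ [h Hh <-] <-] <-] <-]; exists h.
move=> _ [h Hh <-]; exists (f (vertex R (c * h)%g)) => //.
by exists (vertex R (c * h)%g) => //; exists (c * h)%g => //; exists h.
Qed.

(** Translations are isometries, so the constants do not depend on [g] and [c]. Rounding to vertices
    costs 2 in the source, or [L + C] after applying [f]. *)
Lemma phi_coarse_inverse (g : G') (c : G) :
  exists psi, coarse_inverses L (L + C + C + 2) (phi g c) psi.
Proof.
have C0 : 0 <= C by apply: le_trans (mdist_ge0 _ _) (f'f (vertex R 1%g)).
have L_ge0 := L0.
have /choice[rho rhoP] := @vertex_near R G.
exists (fun y => c^-1 * rho (f' (translate g y)))%g; split.
- move=> x y; rewrite mdist_translate (le_trans (fL _ _))//.
  by rewrite -[mdist _ _]/(wdist R _ _) wdist_mull lerD2l; lra.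
- move=> p q; rewrite wdist_mull.
  have e1 := rhoP (f' (translate g p)); have e2 := rhoP (f' (translate g q)).
  have e3 := f'L (translate g p) (translate g q); rewrite mdist_translate in e3.
  have e4 := metric_triangle (vertex R (rho (f' (translate g p))))
    (f' (translate g p)) (vertex R (rho (f' (translate g q)))).
  have e5 := metric_triangle (f' (translate g p))
    (f' (translate g q)) (vertex R (rho (f' (translate g q)))).
  by rewrite metric_sym in e1; rewrite /wdist; lra.
- move=> x; rewrite /phi translateM mulgV translate1.
  rewrite -(wdist_mull R c) mulVKg /wdist.
  have e1 := rhoP (f' (f (vertex R (c * x)%g))).
  rewrite metric_sym in e1; have e2 := f'f (vertex R (c * x)%g).
  by rewrite (le_trans (metric_triangle _ (f' (f (vertex R (c * x)%g))) _))//; lra.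
- move=> p; rewrite /phi mulVKg -(mdist_translate g) translateM mulgV translate1.
  set q := translate g p.
  have e1 := rhoP (f' q); have e2 := fL (vertex R (rho (f' q))) (f' q).
  rewrite metric_sym in e1; have e3 := Lpos e1; have e4 := ff' q.
  by rewrite (le_trans (metric_triangle _ (f (f' q)) _))//; lra.
Qed.

(* Parallel translates [g^-1 f(c H)] and [g0^-1 f(c0 H)] yield the translates
   [g^-1 H'] and [g0^-1 H'] of [H'], hence that [g g0^-1] commensurates [H']. *)
Lemma parallel_Comm (g g0 : G') (c c0 : G) (K : R) : Comm H c -> Comm H c0 ->
  (forall h, H h -> exists2 h1, H h1 & mdist (phi g0 c0 h) (phi g c h1) <= K) ->
  (forall h, H h -> exists2 h1, H h1 & mdist (phi g c h) (phi g0 c0 h1) <= K) ->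
  Comm H' (g * g0^-1)%g.
Proof.
have half (g1 g2 : G') (c1 c2 : G) : Comm H c1 -> Comm H c2 ->
    (forall h, H h -> exists2 h1, H h1 & mdist (phi g2 c2 h) (phi g1 c1 h1) <= K) ->
    exists r : R, forall h, H' h -> tube H' r (g1 * g2^-1 * h)%g.
  move=> /(@Comm_tube R _ _ sH)[r1 [r1P _]] /(@Comm_tube R _ _ sH)[r2 [_ r2P]] par.
  (* The five summands are the lengths of the chain from [g2^-1 h] to [g1^-1 h2] through
     [g2^-1 f(x)], [phi g2 c2 x1], [phi g1 c1 x2] and [g1^-1 f(x3)]. *)
  exists (D + (L * r2 + C) + K + (L * r1 + C) + D) => h /H'f[x Hx hx].
  have [x1 Hx1 xx1] := r2P x Hx; have [x2 Hx2 x12] := par x1 Hx1.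
  have [x3 Hx3 x23] := r1P x2 Hx2; have [h2 Hh2 x3h] := fH Hx3; exists h2 => //.
  have fx1 := le_trans (fL (vertex R x) (vertex R (c2 * x1)%g)) (Lpos xx1).
  have fx3 := le_trans (fL (vertex R (c1 * x2)%g) (vertex R x3)) (Lpos x23).
  rewrite -(wdist_mull R g1^-1) !mulgA mulVg mul1g /wdist.
  rewrite -!translate_vertex -(mdist_translate g2^-1) in hx *.
  rewrite -(mdist_translate g2^-1) in fx1; rewrite -(mdist_translate g1^-1) in fx3.
  rewrite -(mdist_translate g1^-1) in x3h.
  move: hx fx1 x12 fx3 x3h; rewrite /phi.
  set p0 := translate _ (vertex R h); set p1 := translate _ (f (vertex R x)).
  set p2 := translate _ (f _); set p3 := translate _ (f _).
  set p4 := translate _ (f _); set p5 := translate _ (vertex R h2) => d1 d2 d3 d4 d5.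
  have e1 := metric_triangle p0 p1 p5; have e2 := metric_triangle p1 p2 p5.
  have e3 := metric_triangle p2 p3 p5; have e4 := metric_triangle p3 p4 p5.
  by lra.
move=> cc cc0 par par0.
have [r rP] := half g g0 c c0 cc cc0 par; have [q qP] := half g0 g c0 c cc0 cc par0.
apply: (tube_Comm sH' (r := Num.max r q)) => h Hh.
  by apply: tube_le (rP h Hh); rewrite le_max lexx.
have [h1 Hh1 hh1] := qP h Hh; exists h1 => //.
rewrite -(wdist_mull R (g * g0^-1)%g) !mulgA mulgVK mulgV mul1g in hh1.
by rewrite le_max hh1 orbT.
Qed.

Lemma Comm_image : coarsely_3separates R H -> exists K : R, forall c, Comm H c ->
  exists2 a, Comm H' a & mdist (f (vertex R c)) (vertex R a) <= K.
Proof.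
move=> sep; have [r [R0r r0 parallel]] := @parallel_of_noncrossing R G G' H L (L + C + C + 2) L0 sep R0.
have [k k0 ncr] := nc R0r; have [u [K par]] := parallel k k0.
have /choice[rho rhoP] := @vertex_near R G'.
(* This [g c] makes [phi (g c) c] send 1 near 1, so the rounded values [v c i] lie in a finite ball.
   Equal rounded values mean images of [u i] within 2. *)
pose g c := rho (f (vertex R c)); pose v c i := rho (phi (g c) c (u i)).
have close c c0 : Comm H c -> Comm H c0 -> (forall i, v c i = v c0 i) ->
    forall h, H h -> exists2 h1, H h1 &
      mdist (phi (g c0) c0 h) (phi (g c) c h1) <= Num.max K (r + 1).
  move=> cc cc0 vv.
  have mem c1 : Comm H c1 -> [set translate g' @` nbhd r (f @` vertices (lcoset c H))
      | g' in [set: G'] & c in Comm H] (nbhd r (phi (g c1) c1 @` H)).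
    by move=> cc1; exists (g c1)^-1%g => //; exists c1 => //; exact: translate_nbhd_phi.
  (* Noncrossing concerns distinct members only; equal neighborhoods are parallel at once. *)
  have [E|NE] := pselect (nbhd r (phi (g c) c @` H) = nbhd r (phi (g c0) c0 @` H)).
    move=> h Hh; have : nbhd r (phi (g c) c @` H) (phi (g c0) c0 h).
      by rewrite E; apply: (@near_nbhd _ _ _ _ _ (phi (g c0) c0 h)); [exists h|rewrite mdistxx].
    move=> /(nbhd_near (_ : r < r + 1))[|_ [h1 Hh1 <-] hh1]; first by rewrite ltrDl.
    by exists h1 => //; rewrite le_max (ltW hh1) orbT.
  have [psi ci] := phi_coarse_inverse (g c) c.
  have [psi0 ci0] := phi_coarse_inverse (g c0) c0.
  move=> h Hh; have [|||h1 Hh1 hh1] := par _ _ _ _ ci ci0 _ _ _ h Hh.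
  - move=> i; have e1 := rhoP (phi (g c) c (u i)); have e2 := rhoP (phi (g c0) c0 (u i)).
    rewrite -!/(v _ _) (vv i) in e1 e2; rewrite metric_sym in e2.
    by rewrite (le_trans (metric_triangle _ (vertex R (v c0 i)) _))//; lra.
  - by have [F [cF _ YF]] := ncr _ _ (mem c cc) (mem c0 cc0) NE; exists F.
  - have [F [cF _ YF]] := ncr _ _ (mem c0 cc0) (mem c cc) (nesym NE); by exists F.
  - by exists h1 => //; rewrite le_max hh1.
have vfin i : exists M : R, forall c, wdist R 1%g (v c i) <= M.
  exists (L * wdist R (u i) 1%g + C + 2) => c.
  have e1 := rhoP (phi (g c) c (u i)); rewrite -/(v c i) in e1.
  have e2 := rhoP (f (vertex R c)); rewrite -/(g c) in e2.
  have e3 : mdist (vertex R 1%g) (phi (g c) c (u i)) <= 1 + (L * wdist R (u i) 1%g + C).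
    rewrite -(mdist_translate (g c)) translate_vertex mulg1 translateM mulgV translate1.
    rewrite (le_trans (metric_triangle _ (f (vertex R c)) _))// lerD//.
      by rewrite metric_sym.
    by rewrite (le_trans (fL _ _))// -[mdist _ _]/(wdist R _ _) wdistC wdist_mulr.
  have e4 := metric_triangle (vertex R 1%g) (phi (g c) c (u i)) (vertex R (v c i)).
  by rewrite /wdist in e3 *; lra.
have [|||M MP] := @finite_uniform_bound R 'I_3 setT
  (fun i M => forall c, wdist R 1%g (v c i) <= M).
- exact: finite_finset.
- by move=> i a b ab ia c; exact: le_trans ab.
- by move=> i _.
pose i0 : 'I_3 := @Ordinal 3 0 isT; pose i1 : 'I_3 := @Ordinal 3 1 isT.
pose i2 : 'I_3 := @Ordinal 3 2 isT.
pose F := [set x : G' | wdist R 1%g x <= M].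
(* One [c0] is fixed for each triple that occurs. For any [c] with the same triple,
   [g c * (g c0)^-1] is in [Comm H'] and within the length of [g c0] of [g c]. *)
have [|||N NP] := @finite_uniform_bound R (G' * G' * G')%type (F `*` F `*` F)
  (fun z N => forall c, Comm H c -> (v c i0, v c i1, v c i2) = z ->
    exists2 a, Comm H' a & wdist R (g c) a <= N).
- by apply: finite_setX; [apply: finite_setX|]; exact: finite_ball.
- by move=> z a b ab za c cc /(za c cc)[e ? ea]; exists e => //; exact: le_trans ab.
- move=> z _; have [[c0 cc0 c0z]|nz] :=
    pselect (exists2 c0, Comm H c0 & (v c0 i0, v c0 i1, v c0 i2) = z); last first.
    by exists 0 => c cc cz; exfalso; apply: nz; exists c.
  exists (wdist R (g c0) 1%g) => c cc; rewrite -c0z => -[v0 v1 v2].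
  have vv i : v c i = v c0 i.
    by case: i => [[|[|[|//]]] p]; [move: v0|move: v1|move: v2]; rewrite (bool_irrelevance p isT).
  exists (g c * (g c0)^-1)%g.
    by apply: (parallel_Comm cc cc0); exact: close.
  by rewrite wdistC wdist_mulr wdistV1.
exists (1 + N) => c cc.
have [|a ca ga] := NP (v c i0, v c i1, v c i2) _ c cc erefl.
  by split; [split|]; exact: MP.
exists a => //; apply: (le_trans (metric_triangle _ (vertex R (g c)) _)).
by rewrite lerD//; exact: rhoP.
Qed.

End OneDirection.

Theorem corollary7p13 (R : realType) (G G' : fgGroup)
    (f : cayley R G -> cayley R G') (f' : cayley R G' -> cayley R G)
    (H : set G) (H' : set G') :
  quasi_isometry f ->
  subgroup H ->
  (3%:R%:E <= coends R H)%E ->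
  (forall K : set G, subgroup K -> K `<=` H -> ~ finite_index K H ->
    coends R K = 1%:E) ->
  (exists2 R1 : R, 0 <= R1 & forall r : R, R1 <= r ->
    noncrossing_subset (nbhd r (f @` vertices H))) ->
  subgroup H' ->
  (dHaus (vertices H') (f @` vertices H) < +oo)%E ->
  quasi_inverse f f' ->
  (exists2 R0 : R, 0 < R0 & forall r : R, R0 < r ->
    noncrossing [set translate g @` nbhd r (f' @` vertices (lcoset c' H'))
                | g in [set: G] & c' in Comm H'] /\
    noncrossing [set translate g' @` nbhd r (f @` vertices (lcoset c H))
                | g' in [set: G'] & c in Comm H]) ->
  (dHaus (vertices (Comm H')) (f @` vertices (Comm H)) < +oo)%E.
Proof.
move=> [L1 [C1 [L1_1 C1_0 fQ _]]] sH H3 H_1 _ sH' /dHaus_fin[D [D0 H'f0 fH0]].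
move=> [[L2 [C2 [L2_1 C2_0 f'Q _]]] [C3 [C3f' C3f]]] [R0 _ nc].
pose L := Num.max L1 L2; pose C := Num.max (Num.max C1 C2) C3.
have L1L : L1 <= L by rewrite le_max lexx.
have L2L : L2 <= L by rewrite le_max lexx orbT.
have L0 : 0 <= L by lra.
have C1C : C1 <= C by rewrite !le_max lexx.
have C2C : C2 <= C by rewrite !le_max lexx orbT.
have C3C : C3 <= C by rewrite le_max lexx orbT.
have fL x y : mdist (f x) (f y) <= L * mdist x y + C.
  have /andP[_ h] := fQ x y; rewrite (le_trans h)// lerD//.
  by rewrite ler_wpM2r// mdist_ge0.
have f'L x y : mdist (f' x) (f' y) <= L * mdist x y + C.
  have /andP[_ h] := f'Q x y; rewrite (le_trans h)// lerD//.
  by rewrite ler_wpM2r// mdist_ge0.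
have f'f x : mdist (f' (f x)) x <= C by rewrite (le_trans (C3f' x)).
have ff' y : mdist (f (f' y)) y <= C by rewrite (le_trans (C3f y)).
have fH h : H h -> exists2 h', H' h' & mdist (f (vertex R h)) (vertex R h') <= D.
  move=> Hh; have [|_ [h' Hh' <-] hh'] := fH0 (f (vertex R h)).
    by exists (vertex R h) => //; exists h.
  by exists h'.
have H'f h' : H' h' -> exists2 h, H h & mdist (vertex R h') (f (vertex R h)) <= D.
  move=> Hh'; have [|_ [_ [h Hh <-] <-] hh'] := H'f0 (vertex R h'); first by exists h'.
  by exists h.
have shift h h' : mdist (f (vertex R h)) (vertex R h') <= D ->
    mdist (f' (vertex R h')) (vertex R h) <= L * D + C + C.
  move=> hD; have e1 := f'L (f (vertex R h)) (vertex R h'); have e2 := f'f (vertex R h).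
  have e3 := ler_wpM2l L0 hD; rewrite metric_sym in e1.
  by rewrite (le_trans (metric_triangle _ (f' (f (vertex R h))) _))//; lra.
have sep := coends_3separates sH H3 H_1.
(* The hypotheses on coends concern [H] alone; for the reverse direction the coarse property is
   carried to [H'] along [f] and [f'] rounded to vertices. *)
have sep' : coarsely_3separates R H'.
  have /choice[rho rhoP] := @vertex_near R G.
  have /choice[rho' rhoP'] := @vertex_near R G'.
  pose a x := rho' (f (vertex R x)); pose b y := rho (f' (vertex R y)).
  have aP x : mdist (f (vertex R x)) (vertex R (a x)) <= 1 by exact: rhoP'.
  have bP y : mdist (f' (vertex R y)) (vertex R (b y)) <= 1 by exact: rhoP.
  apply: (@coarsely_3separates_transfer R G G' H H' a b L (L + C + C + 2) (D + 1)) => //.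
  - move=> x y; have e1 := aP x; have e2 := aP y; have e3 := fL (vertex R x) (vertex R y).
    have e4 := metric_triangle (vertex R (a x)) (f (vertex R x)) (vertex R (a y)).
    have e5 := metric_triangle (f (vertex R x)) (f (vertex R y)) (vertex R (a y)).
    by rewrite metric_sym in e1; rewrite /wdist; lra.
  - move=> x y; have e1 := bP x; have e2 := bP y; have e3 := f'L (vertex R x) (vertex R y).
    have e4 := metric_triangle (vertex R (b x)) (f' (vertex R x)) (vertex R (b y)).
    have e5 := metric_triangle (f' (vertex R x)) (f' (vertex R y)) (vertex R (b y)).
    by rewrite metric_sym in e1; rewrite /wdist; lra.
  - move=> x; have e1 := bP (a x); have e2 := f'L (vertex R (a x)) (f (vertex R x)).
    have e3 := aP x; rewrite metric_sym in e1; rewrite metric_sym in e3.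
    have e4 := ler_wpM2l L0 e3; have e5 := f'f (vertex R x).
    have e6 := metric_triangle (vertex R (b (a x))) (f' (vertex R (a x))) (vertex R x).
    have e7 := metric_triangle (f' (vertex R (a x))) (f' (f (vertex R x))) (vertex R x).
    by rewrite /wdist; lra.
  - move=> x; have e1 := aP (b x); have e2 := fL (vertex R (b x)) (f' (vertex R x)).
    have e3 := bP x; rewrite metric_sym in e1; rewrite metric_sym in e3.
    have e4 := ler_wpM2l L0 e3; have e5 := ff' (vertex R x).
    have e6 := metric_triangle (vertex R (a (b x))) (f (vertex R (b x))) (vertex R x).
    have e7 := metric_triangle (f (vertex R (b x))) (f (f' (vertex R x))) (vertex R x).
    by rewrite /wdist; lra.
  - move=> h /fH[h' Hh' hh']; exists h' => //; have e1 := aP h; rewrite metric_sym in e1.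
    by rewrite /wdist (le_trans (metric_triangle _ (f (vertex R h)) _))//; lra.
  - move=> h' /H'f[h Hh hh']; exists h => //; have e1 := aP h.
    by rewrite /wdist (le_trans (metric_triangle _ (f (vertex R h)) _))//; lra.
have [K KP] : exists K : R, forall c, Comm H c ->
    exists2 a, Comm H' a & mdist (f (vertex R c)) (vertex R a) <= K.
  by apply: (Comm_image L0 sH sH' fL f'L f'f ff' fH H'f _ sep) => r /nc[].
have [K' KP'] : exists K : R, forall c, Comm H' c ->
    exists2 a, Comm H a & mdist (f' (vertex R c)) (vertex R a) <= K.
  apply: (Comm_image L0 sH' sH f'L fL ff' f'f _ _ _ sep') => [h' /H'f[h Hh hh']|h /fH[h' Hh' hh']|r /nc[]].
  - by exists h => //; apply: shift; rewrite metric_sym.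
  - by exists h' => //; rewrite metric_sym; exact: shift.
  - by move=> ? ?; eassumption.
(* For [c'] in [Comm H'], [f' c'] is near some [a] in [Comm H]; applying [f], with [f f'] close to
   the identity, puts [c'] near [f a]. *)
apply: (@fin_dHaus _ _ _ _ (C + (L * K' + C)) K).
- move=> _ [c' cc' <-]; have [a ca ac] := KP' c' cc'.
  exists (f (vertex R a)); first by exists (vertex R a) => //; exists a.
  rewrite (le_trans (metric_triangle _ (f (f' (vertex R c'))) _))// lerD//.
    by rewrite metric_sym.
  by rewrite (le_trans (fL _ _))// lerD2r ler_wpM2l.
- move=> _ [_ [c cc <-] <-]; have [a ca ac] := KP c cc.
  by exists (vertex R a) => //; exists a.
Qed.
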